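(* Let $(A,P_A)$ be a commutative Rota-Baxter $\mathbf{k}$-algebra of weight zero and let $S$ be a multiplicative subset of $A$. Suppose $S^{-1}A=A\oplus V$ as $\mathbf{k}$-modules, where the summand $A$ denotes the image of $A$ in $S^{-1}A$ and $V$ is a $\mathbf{k}$-submodule of $S^{-1}A$. Then the Rota-Baxter localization of $A$ at $S$ is $$S^{-1}_{RB}A=S^{-1}A\oplus\bigoplus_{k\ge 1}\big(S^{-1}A\otimes V^{\otimes k}\big)$$ with the extended shuffle product. In other words, it is the tensor product algebra $$S^{-1}_{RB}A=S^{-1}A\otimes\Big(\bigoplus_{k\ge 0}V^{\otimes k}\Big),$$ where the second tensor factor is the shuffle product algebra on $V$. That is, this $\mathbf{k}$-algebra carries a Rota-Baxter operator of weight zero with which, together with the canonical map from $A$ into its component $S^{-1}A$, it is the Rota-Baxter localization of $(A,P_A)$ at $S$.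
   Context: $\mathbf{k}$ is a commutative unitary ring and all algebras are commutative unital $\mathbf{k}$-algebras. A Rota-Baxter algebra of weight zero is a pair $(R,P)$ with $R$ an algebra and $P:R\to R$ a $\mathbf{k}$-linear map satisfying $P(x)P(y)=P(xP(y)+P(x)y)$ for all $x,y\in R$. A morphism $f:(R,P)\to(R',P')$ is an algebra homomorphism with $f\circ P=P'\circ f$. $S^{-1}A$ denotes the usual localization of the commutative algebra $A$, and tensor products are over $\mathbf{k}$. Rota-Baxter localization (in weight zero): for a multiplicative subset $S\subseteq R$, it is a commutative Rota-Baxter algebra $(S^{-1}_{RB}R,S^{-1}P)$ of weight zero with a Rota-Baxter homomorphism $i_S:R\to S^{-1}_{RB}R$ such that (1) the elements of $i_S(S)$ are invertible; (2) for every commutative Rota-Baxter algebra $(R',P_{R'})$ of weight zero and Rota-Baxter homomorphism $f:R\to R'$ such that $f(S)$ consists of invertible elements, there is a unique Rota-Baxter homomorphism $f_S:S^{-1}_{RB}R\to R'$ with $f_S\circ i_S=f$. The shuffle product algebra on $V$ is $\bigoplus_{k\ge 0}V^{\otimes k}$ (with $V^{\otimes 0}=\mathbf{k}$), where the product of $v_1\otimes\cdots\otimes v_m$ and $w_1\otimes\cdots\otimes w_n$ is the sum over all $(m,n)$-shuffles of the $m+n$ tensor factors; it uses no multiplication on $V$. The extended shuffle product is $$(a_0\otimes\mathfrak v)(b_0\otimes\mathfrak w)=(a_0b_0)\otimes(\mathfrak v\,\text{shuffled with}\,\mathfrak w)$$ for $a_0,b_0\in S^{-1}A$, $\mathfrak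 v\in V^{\otimes m}$, $\mathfrak w\in V^{\otimes n}$.
   Formalization: The formal theorem additionally assumes that P_A maps the kernel of A → S⁻¹A into itself, so that the image of A inherits the operator; this is automatic if A → S⁻¹A is injective, and without it the canonical map need not commute with any operator. *)

(* Defs.v *)
From HB Require Import structures.
From mathcomp Require Import all_boot all_algebra.
From mathcomp Require Import ring.
From mathcomp Require Import boolp.

Set Implicit Arguments.
Unset Strict Implicit.
Unset Printing Implicit Defensive.

Import GRing.Theory.
Local Open Scope ring_scope.
Local Open Scope quotient_scope.

(* The library's [comAlgType k] excludes the zero ring, which does occur here:
   localizing at a set that contains 0 gives the zero algebra. *)
HB.mixin Record ComPzRing_isAlgebra (k : pzRingType) V of GRing.ComPzRing V := {
  algscale : k -> V -> V;
  algscalerA : forall a b v, algscale a (algscale b v) = algscale (a * b) v;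
  algscale1r : left_id 1 algscale;
  algscalerDr : right_distributive algscale +%R;
  algscalerDl : forall v, {morph algscale^~ v : a b / a + b};
  algscalerAl : forall (a : k) (u v : V),
    algscale a (u * v) = algscale a u * v
}.

#[short(type="comPzAlgType")]
HB.structure Definition ComPzAlgebra (k : pzRingType) :=
  {V of GRing.ComPzRing V & ComPzRing_isAlgebra k V}.

#[non_forgetful_inheritance]
HB.instance Definition _ (k : pzRingType) (A : comPzAlgType k) :=
  GRing.Zmodule_isLmodule.Build k (A : Type) (@algscalerA k A) (@algscale1r k A)
    (@algscalerDr k A) (@algscalerDl k A).

Section AlgebraTheory.
Variables (k : pzRingType) (A : comPzAlgType k).

Lemma pzscalerAl (c : k) (x y : A) : c *: (x * y) = (c *: x) * y.
Proof. exact: algscalerAl. Qed.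

Lemma pzscalerAr (c : k) (x y : A) : c *: (x * y) = x * (c *: y).
Proof. by rewrite mulrC pzscalerAl mulrC. Qed.

End AlgebraTheory.

Definition alg_hom (k : pzRingType) (A B : comPzAlgType k) (f : A -> B) : Prop :=
  linear f /\ monoid_morphism f.

(* Rota-Baxter operators are of weight zero throughout. *)
Definition rota_baxter (k : pzRingType) (R : comPzAlgType k) (P : R -> R) : Prop :=
  linear P /\ forall x y, P x * P y = P (x * P y + P x * y).

Definition rb_hom (k : pzRingType) (R R' : comPzAlgType k)
    (P : R -> R) (P' : R' -> R') (f : R -> R') : Prop :=
  alg_hom f /\ forall x, f (P x) = P' (f x).

Definition invertible (R : comPzRingType) (x : R) : Prop := exists y, x * y = 1.

Definition rb_localization (k : pzRingType) (A : comPzAlgType k) (P : A -> A)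
    (S : {pred A}) (B : comPzAlgType k) (Q : B -> B) (i : A -> B) : Prop :=
  [/\ rota_baxter Q, rb_hom P Q i, forall s, s \in S -> invertible (i s) &
    forall (R : comPzAlgType k) (PR : R -> R) (f : A -> R),
      rota_baxter PR -> rb_hom P PR f ->
      (forall s, s \in S -> invertible (f s)) ->
      exists g : B -> R, [/\ rb_hom Q PR g, forall a, g (i a) = f a &
        forall h : B -> R, rb_hom Q PR h -> (forall a, h (i a) = f a) ->
          h =1 g]].

Section Localization.
Variables (k : pzRingType) (A : comPzAlgType k) (S : mulrClosed A).

Definition frac : Type := (A * {s : A | s \in S})%type.
HB.instance Definition _ := Choice.on frac.

Definition frac_eq (x y : frac) : bool :=
  `[< exists2 u, u \in S & u * (x.1 * sval y.2) = u * (y.1 * sval x.2) >].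

Lemma frac_eq_refl : reflexive frac_eq.
Proof. by move=> x; apply/asboolP; exists 1 => //; apply: rpred1. Qed.

Lemma frac_eq_sym : symmetric frac_eq.
Proof.
by move=> x y; apply/asboolP/asboolP => -[u Su e]; exists u; rewrite // e.
Qed.

Lemma frac_eq_trans : transitive frac_eq.
Proof.
move=> y x z /asboolP[u Su e1] /asboolP[v Sv e2]; apply/asboolP.
exists (u * v * sval y.2); first by rewrite !rpredM //; apply: (valP y.2).
have -> : u * v * sval y.2 * (x.1 * sval z.2)
   = v * sval z.2 * (u * (x.1 * sval y.2)) by ring.
have -> : u * v * sval y.2 * (z.1 * sval x.2)
   = u * sval x.2 * (v * (z.1 * sval y.2)) by ring.
by rewrite e1 -e2; ring.
Qed.

Canonical frac_equiv := EquivRel frac_eq frac_eq_refl frac_eq_sym frac_eq_trans.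

Definition loc_type : Type := {eq_quot frac_eq}.
HB.instance Definition _ := Choice.on loc_type.

Definition den1 : {s : A | s \in S} := exist _ 1 (rpred1 S).
Fact denM_subproof (s t : {s : A | s \in S}) : sval s * sval t \in S.
Proof. by apply: rpredM; [apply: (valP s) | apply: (valP t)]. Qed.
Definition denM (s t : {s : A | s \in S}) : {s : A | s \in S} :=
  exist _ (sval s * sval t) (denM_subproof s t).

Definition frac_class (x : frac) : loc_type := \pi_({eq_quot frac_eq}) x.

Lemma frac_classP x y : frac_class x = frac_class y <->
  exists2 u, u \in S & u * (x.1 * sval y.2) = u * (y.1 * sval x.2).
Proof.
split=> [/eqP|e].
  by rewrite /frac_class eqmodE => /asboolP.
by apply/eqP; rewrite /frac_class eqmodE; apply/asboolP.
Qed.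

Lemma frac_class_surj (q : loc_type) : exists x, q = frac_class x.
Proof. by exists (repr q); rewrite /frac_class reprK. Qed.

Lemma frac_repr x : exists2 u, u \in S &
  u * ((repr (frac_class x)).1 * sval x.2) =
  u * (x.1 * sval (repr (frac_class x)).2).
Proof. by apply/frac_classP; rewrite {1}/frac_class reprK. Qed.

Definition loc_add (p q : loc_type) : loc_type :=
  let x := repr p in let y := repr q in
  frac_class (x.1 * sval y.2 + y.1 * sval x.2, denM x.2 y.2).
Definition loc_mul (p q : loc_type) : loc_type :=
  let x := repr p in let y := repr q in frac_class (x.1 * y.1, denM x.2 y.2).
Definition loc_opp (p : loc_type) : loc_type :=
  frac_class (- (repr p).1, (repr p).2).
Definition loc_scale (c : k) (p : loc_type) : loc_type :=
  frac_class (c *: (repr p).1, (repr p).2).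
Definition loc_map (a : A) : loc_type := frac_class (a, den1).

Lemma loc_addE x y : loc_add (frac_class x) (frac_class y) =
  frac_class (x.1 * sval y.2 + y.1 * sval x.2, denM x.2 y.2).
Proof.
apply/frac_classP; have [u Su eu] := frac_repr x; have [v Sv ev] := frac_repr y.
exists (u * v); rewrite ?rpredM //=.
move: (repr (frac_class x)) (repr (frac_class y)) eu ev => x' y' eu ev.
have -> : u * v * ((x'.1 * sval y'.2 + y'.1 * sval x'.2) * (sval x.2 * sval y.2))
  = (u * (x'.1 * sval x.2)) * (v * sval y'.2 * sval y.2)
    + (v * (y'.1 * sval y.2)) * (u * sval x'.2 * sval x.2) by ring.
by rewrite eu ev; ring.
Qed.

Lemma loc_mulE x y : loc_mul (frac_class x) (frac_class y) =
  frac_class (x.1 * y.1, denM x.2 y.2).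
Proof.
apply/frac_classP; have [u Su eu] := frac_repr x; have [v Sv ev] := frac_repr y.
exists (u * v); rewrite ?rpredM //=.
move: (repr (frac_class x)) (repr (frac_class y)) eu ev => x' y' eu ev.
have -> : u * v * ((x'.1 * y'.1) * (sval x.2 * sval y.2))
  = (u * (x'.1 * sval x.2)) * (v * (y'.1 * sval y.2)) by ring.
by rewrite eu ev; ring.
Qed.

Lemma loc_oppE x : loc_opp (frac_class x) = frac_class (- x.1, x.2).
Proof.
apply/frac_classP; have [u Su eu] := frac_repr x.
by exists u => //=; rewrite !mulNr !mulrN eu.
Qed.

Lemma loc_scaleE c x : loc_scale c (frac_class x) = frac_class (c *: x.1, x.2).
Proof.
apply/frac_classP; have [u Su eu] := frac_repr x.
by exists u => //=; rewrite -!pzscalerAl -!pzscalerAr eu.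
Qed.

Lemma frac_class_eq x y : x.1 * sval y.2 = y.1 * sval x.2 ->
  frac_class x = frac_class y.
Proof. by move=> e; apply/frac_classP; exists 1; rewrite ?rpred1 // e. Qed.

Fact loc_addA : associative loc_add.
Proof.
move=> p q r; have [x ->] := frac_class_surj p; have [y ->] := frac_class_surj q.
have [z ->] := frac_class_surj r.
by rewrite !loc_addE; apply: frac_class_eq => /=; ring.
Qed.

Fact loc_addC : commutative loc_add.
Proof.
move=> p q; have [x ->] := frac_class_surj p; have [y ->] := frac_class_surj q.
by rewrite !loc_addE; apply: frac_class_eq => /=; ring.
Qed.

Fact loc_add0 : left_id (loc_map 0) loc_add.
Proof.
move=> p; have [x ->] := frac_class_surj p.
by rewrite !loc_addE; apply: frac_class_eq => /=; ring.
Qed.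

Fact loc_addN : left_inverse (loc_map 0) loc_opp loc_add.
Proof.
move=> p; have [x ->] := frac_class_surj p.
by rewrite loc_oppE loc_addE; apply: frac_class_eq => /=; ring.
Qed.

HB.instance Definition _ := GRing.isZmodule.Build loc_type
  loc_addA loc_addC loc_add0 loc_addN.

Fact loc_mulA : associative loc_mul.
Proof.
move=> p q r; have [x ->] := frac_class_surj p; have [y ->] := frac_class_surj q.
have [z ->] := frac_class_surj r.
by rewrite !loc_mulE; apply: frac_class_eq => /=; ring.
Qed.

Fact loc_mulC : commutative loc_mul.
Proof.
move=> p q; have [x ->] := frac_class_surj p; have [y ->] := frac_class_surj q.
by rewrite !loc_mulE; apply: frac_class_eq => /=; ring.
Qed.

Fact loc_mul1 : left_id (loc_map 1) loc_mul.
Proof.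
move=> p; have [x ->] := frac_class_surj p.
by rewrite !loc_mulE; apply: frac_class_eq => /=; ring.
Qed.

Fact loc_mulDl : left_distributive loc_mul +%R.
Proof.
move=> p q r; have [x ->] := frac_class_surj p; have [y ->] := frac_class_surj q.
have [z ->] := frac_class_surj r.
change (loc_mul (loc_add (frac_class x) (frac_class y)) (frac_class z) =
  loc_add (loc_mul (frac_class x) (frac_class z))
          (loc_mul (frac_class y) (frac_class z))).
rewrite loc_addE !loc_mulE loc_addE.
by apply: frac_class_eq => /=; ring.
Qed.

HB.instance Definition _ := GRing.Zmodule_isComPzRing.Build loc_type
  loc_mulA loc_mulC loc_mul1 loc_mulDl.

Fact loc_scalerA a b p : loc_scale a (loc_scale b p) = loc_scale (a * b) p.
Proof.
by have [x ->] := frac_class_surj p; rewrite !loc_scaleE /= scalerA.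
Qed.

Fact loc_scale1r : left_id 1 loc_scale.
Proof.
by move=> p; have [[x s] ->] := frac_class_surj p; rewrite loc_scaleE /= scale1r.
Qed.

Fact loc_scalerDr : right_distributive loc_scale +%R.
Proof.
move=> c p q; have [x ->] := frac_class_surj p; have [y ->] := frac_class_surj q.
change (loc_scale c (loc_add (frac_class x) (frac_class y)) =
  loc_add (loc_scale c (frac_class x)) (loc_scale c (frac_class y))).
rewrite loc_addE !loc_scaleE loc_addE /=; apply: frac_class_eq => /=.
by rewrite scalerDr -!pzscalerAl.
Qed.

Fact loc_scalerDl p : {morph loc_scale^~ p : a b / a + b}.
Proof.
move=> a b; have [x ->] := frac_class_surj p.
change (loc_scale (a + b) (frac_class x) =
  loc_add (loc_scale a (frac_class x)) (loc_scale b (frac_class x))).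
rewrite !loc_scaleE loc_addE /=; apply: frac_class_eq => /=.
by rewrite scalerDl !mulrDl; ring.
Qed.

Fact loc_scalerAl c p q : loc_scale c (p * q) = loc_scale c p * q.
Proof.
have [x ->] := frac_class_surj p; have [y ->] := frac_class_surj q.
change (loc_scale c (loc_mul (frac_class x) (frac_class y)) =
  loc_mul (loc_scale c (frac_class x)) (frac_class y)).
rewrite loc_mulE !loc_scaleE loc_mulE /=; apply: frac_class_eq => /=.
by rewrite -!pzscalerAl.
Qed.

HB.instance Definition _ := ComPzRing_isAlgebra.Build k loc_type
  loc_scalerA loc_scale1r loc_scalerDr loc_scalerDl loc_scalerAl.

Definition localization : comPzAlgType k := loc_type.

Lemma loc_map_hom : alg_hom (loc_map : A -> localization).
Proof.
split; last split.
- move=> c a b.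
  change (loc_map (c *: a + b) = loc_add (loc_scale c (loc_map a)) (loc_map b)).
  rewrite /loc_map loc_scaleE loc_addE; apply: frac_class_eq => /=; ring.
- by [].
- move=> a b; change (loc_map (a * b) = loc_mul (loc_map a) (loc_map b)).
  by rewrite /loc_map loc_mulE; apply: frac_class_eq => /=; ring.
Qed.

Lemma loc_map_inv s : s \in S -> invertible (loc_map s : localization).
Proof.
move=> Ss; exists (frac_class (1, exist _ s Ss)).
change (loc_mul (loc_map s) (frac_class (1, exist _ s Ss)) = loc_map 1).
by rewrite loc_mulE; apply: frac_class_eq => /=; ring.
Qed.

Lemma loc_surj (q : localization) :
  exists a s, s \in S /\ q * loc_map s = loc_map a.
Proof.
have [x ->] := frac_class_surj q; exists x.1, (sval x.2); split.
  exact: (valP x.2).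
change (loc_mul (frac_class x) (loc_map (sval x.2)) = loc_map x.1).
by rewrite loc_mulE; apply: frac_class_eq => /=; ring.
Qed.

Lemma loc_map_eq0 a : loc_map a = 0 :> localization <->
  exists2 u, u \in S & u * a = 0.
Proof.
split.
- by move/frac_classP => [u Su /=]; rewrite mulr1 mul0r mulr0; exists u.
- move=> [u Su e]; apply/frac_classP; exists u => //=.
  by rewrite mulr1 mul0r mulr0.
Qed.

End Localization.

Section LinearPredicate.
Variables (k : pzRingType) (U W : lmodType k) (f : U -> W).
Hypothesis linf : linear f.

Lemma lin0 : f 0 = 0.
Proof.
by have := linf (-1) 0 0; rewrite scaler0 addr0 scaleN1r addNr.
Qed.

Lemma lin_scale c x : f (c *: x) = c *: f x.
Proof. by rewrite -[c *: x]addr0 linf lin0 addr0. Qed.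

Lemma lin_add x y : f (x + y) = f x + f y.
Proof. by rewrite -[x in LHS]scale1r linf scale1r. Qed.

Lemma lin_sum (I : Type) (r : seq I) (F : I -> U) :
  f (\sum_(i <- r) F i) = \sum_(i <- r) f (F i).
Proof.
elim: r => [|i r IH]; first by rewrite !big_nil lin0.
by rewrite !big_cons lin_add IH.
Qed.

End LinearPredicate.

Section Tensor.
Variables (k : comPzRingType) (M N : lmodType k).

Definition bilin (W : lmodType k) (f : M -> N -> W) : Prop :=
  (forall n, linear (f^~ n)) /\ (forall m, linear (f m)).

(* A formal sum of pure tensors is a list; two of them represent the same tensor
   when no bilinear map distinguishes them. *)
Definition tsum (W : lmodType k) (f : M -> N -> W) (s : seq (M * N)) : W :=
  \sum_(p <- s) f p.1 p.2.

Definition teq (s t : seq (M * N)) : bool :=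
  `[< forall (W : lmodType k) (f : M -> N -> W), bilin f ->
      tsum f s = tsum f t >].

Lemma teq_refl : reflexive teq.
Proof. by move=> s; apply/asboolP. Qed.

Lemma teq_sym : symmetric teq.
Proof. by move=> s t; apply/asboolP/asboolP => e W f bf; rewrite e. Qed.

Lemma teq_trans : transitive teq.
Proof.
move=> t s r /asboolP e1 /asboolP e2; apply/asboolP => W f bf.
by rewrite e1 // e2.
Qed.

Canonical teq_equiv := EquivRel teq teq_refl teq_sym teq_trans.

Definition tensor : Type := {eq_quot teq}.
HB.instance Definition _ := Choice.on tensor.

Definition tclass (s : seq (M * N)) : tensor := \pi_({eq_quot teq}) s.

Definition tens (m : M) (n : N) : tensor := tclass [:: (m, n)].

Definition tensor_lift (W : lmodType k) (f : M -> N -> W) (x : tensor) : W :=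
  tsum f (repr x).

Lemma tclassP s t : tclass s = tclass t <->
  (forall (W : lmodType k) (f : M -> N -> W), bilin f -> tsum f s = tsum f t).
Proof.
split=> [/eqP|e].
  by rewrite /tclass eqmodE => /asboolP.
by apply/eqP; rewrite /tclass eqmodE; apply/asboolP.
Qed.

Lemma tclass_surj x : exists s, x = tclass s.
Proof. by exists (repr x); rewrite /tclass reprK. Qed.

Lemma tensor_liftE (W : lmodType k) (f : M -> N -> W) s :
  bilin f -> tensor_lift f (tclass s) = tsum f s.
Proof.
by move=> bf; apply/(tclassP _ _).1 => //; rewrite /tclass reprK.
Qed.

Lemma tsum_cat (W : lmodType k) (f : M -> N -> W) s t : tsum f (s ++ t) = tsum f s + tsum f t.
Proof. exact: big_cat. Qed.

Definition tscale (c : k) (s : seq (M * N)) := [seq (c *: p.1, p.2) | p <- s].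

Lemma tsum_scale (W : lmodType k) (f : M -> N -> W) c s :
  bilin f -> tsum f (tscale c s) = c *: tsum f s.
Proof.
move=> [bf _]; rewrite /tsum big_map scaler_sumr; apply: eq_bigr => p _ /=.
exact: lin_scale (bf p.2) _ _.
Qed.

Definition tadd (x y : tensor) : tensor := tclass (repr x ++ repr y).
Definition tscl (c : k) (x : tensor) : tensor := tclass (tscale c (repr x)).
Definition topp := tscl (-1).
Definition tzero : tensor := tclass [::].

Lemma taddE s t : tadd (tclass s) (tclass t) = tclass (s ++ t).
Proof.
apply/tclassP => W f bf; rewrite !tsum_cat.
by rewrite -!(tensor_liftE _ bf) /tensor_lift /tclass !reprK.
Qed.

Lemma tsclE c s : tscl c (tclass s) = tclass (tscale c s).
Proof.
apply/tclassP => W f bf; rewrite !tsum_scale //.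
by rewrite -!(tensor_liftE _ bf) /tensor_lift /tclass !reprK.
Qed.

Fact taddA : associative tadd.
Proof.
move=> x y z; have [s ->] := tclass_surj x; have [t ->] := tclass_surj y.
by have [r ->] := tclass_surj z; rewrite !taddE catA.
Qed.

Fact taddC : commutative tadd.
Proof.
move=> x y; have [s ->] := tclass_surj x; have [t ->] := tclass_surj y.
by rewrite !taddE; apply/tclassP => W f _; rewrite !tsum_cat addrC.
Qed.

Fact tadd0 : left_id tzero tadd.
Proof. by move=> x; have [s ->] := tclass_surj x; rewrite taddE. Qed.

Fact taddN : left_inverse tzero topp tadd.
Proof.
move=> x; have [s ->] := tclass_surj x.
rewrite /topp tsclE taddE; apply/tclassP => W f bf.
by rewrite tsum_cat tsum_scale // scaleN1r addNr /tsum big_nil.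
Qed.

HB.instance Definition _ := GRing.isZmodule.Build tensor taddA taddC tadd0 taddN.

Fact tsclA a b x : tscl a (tscl b x) = tscl (a * b) x.
Proof.
have [s ->] := tclass_surj x; rewrite !tsclE; apply/tclassP => W f bf.
by rewrite !tsum_scale // scalerA.
Qed.

Fact tscl1 : left_id 1 tscl.
Proof.
move=> x; have [s ->] := tclass_surj x; rewrite !tsclE; apply/tclassP => W f bf.
by rewrite !tsum_scale // scale1r.
Qed.

Fact tsclDr : right_distributive tscl +%R.
Proof.
move=> c x y; change (tscl c (tadd x y) = tadd (tscl c x) (tscl c y)).
have [s ->] := tclass_surj x; have [t ->] := tclass_surj y.
by rewrite taddE !tsclE taddE /tscale map_cat.
Qed.

Fact tsclDl x : {morph tscl^~ x : a b / a + b}.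
Proof.
move=> a b; change (tscl (a + b) x = tadd (tscl a x) (tscl b x)).
have [s ->] := tclass_surj x; rewrite !tsclE taddE; apply/tclassP => W f bf.
by rewrite tsum_cat !tsum_scale // scalerDl.
Qed.

HB.instance Definition _ := GRing.Zmodule_isLmodule.Build k tensor
  tsclA tscl1 tsclDr tsclDl.

Lemma tensor_lift_tens (W : lmodType k) (f : M -> N -> W) m n :
  bilin f -> tensor_lift f (tens m n) = f m n.
Proof. by move=> bf; rewrite tensor_liftE // /tsum big_seq1. Qed.

Lemma tensor_lift_linear (W : lmodType k) (f : M -> N -> W) :
  bilin f -> linear (tensor_lift f).
Proof.
move=> bf c x y.
change (tensor_lift f (tadd (tscl c x) y) = c *: tensor_lift f x + tensor_lift f y).
have [s ->] := tclass_surj x; have [t ->] := tclass_surj y.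
by rewrite tsclE taddE !tensor_liftE // tsum_cat tsum_scale.
Qed.

Lemma tens_bilin : bilin tens.
Proof.
split=> [n c m m'|m c n n'].
  change (tens (c *: m + m') n = tadd (tscl c (tens m n)) (tens m' n)).
  rewrite /tens tsclE taddE; apply/tclassP => W f bf.
  by rewrite tsum_cat tsum_scale // /tsum !big_seq1 /= bf.1.
change (tens m (c *: n + n') = tadd (tscl c (tens m n)) (tens m n')).
rewrite /tens tsclE taddE; apply/tclassP => W f bf.
by rewrite tsum_cat tsum_scale // /tsum !big_seq1 /= bf.2.
Qed.

Lemma tensor_sum x : exists s : seq (M * N), x = \sum_(p <- s) tens p.1 p.2.
Proof.
have [s ->] := tclass_surj x; exists s; elim: s => [|[m n] s IH].
  by rewrite big_nil.
rewrite big_cons -IH; change (tclass ((m, n) :: s) = tadd (tens m n) (tclass s)).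
by rewrite /tens taddE.
Qed.

Lemma tensor_lift_comb (W : lmodType k) (f g : M -> N -> W) c x :
  tensor_lift (fun m n => c *: f m n + g m n) x =
  c *: tensor_lift f x + tensor_lift g x.
Proof. by rewrite /tensor_lift /tsum big_split scaler_sumr. Qed.

Lemma eq_tensor_lift (W : lmodType k) (f g : M -> N -> W) :
  f =2 g -> tensor_lift f =1 tensor_lift g.
Proof. by move=> e x; apply: eq_bigr => p _; apply: e. Qed.

End Tensor.

Section TensorPower.
Variables (k : comPzRingType) (V : lmodType k).

Fixpoint tpow (n : nat) : lmodType k :=
  if n is n'.+1 then tensor V (tpow n') else k^o.

Fixpoint ptens (s : seq V) : tpow (size s) :=
  match s return tpow (size s) with
  | [::] => (1 : k^o)
  | v :: s' => tens v (ptens s')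
  end.

Definition multilinear (W : lmodType k) (f : seq V -> W) : Prop :=
  forall s1 s2, linear (fun v => f (s1 ++ v :: s2)).

Fixpoint tpow_lift (W : lmodType k) (n : nat) (f : seq V -> W) : tpow n -> W :=
  match n return tpow n -> W with
  | 0 => fun c : k^o => (c : k) *: f [::]
  | n'.+1 => tensor_lift (fun v => tpow_lift (fun s => f (v :: s)))
  end.

Lemma multilinear_cons (W : lmodType k) (f : seq V -> W) v :
  multilinear f -> multilinear (fun s => f (v :: s)).
Proof. by move=> mf s1 s2; apply: (mf (v :: s1)). Qed.

Lemma eq_tpow_lift (W : lmodType k) n (f g : seq V -> W) :
  f =1 g -> tpow_lift (n := n) f =1 tpow_lift g.
Proof.
elim: n f g => [|n IH] f g e x /=; first by rewrite e.
by apply: eq_tensor_lift => v y; apply: IH => s.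
Qed.

Lemma tpow_lift_comb (W : lmodType k) n c (f g : seq V -> W) (x : tpow n) :
  tpow_lift (fun s => c *: f s + g s) x = c *: tpow_lift f x + tpow_lift g x.
Proof.
elim: n f g x => [|n IH] f g x /=; first by rewrite scalerDr !scalerA mulrC.
by rewrite -tensor_lift_comb; apply: eq_tensor_lift => v y; apply: IH.
Qed.

Lemma tpow_lift_linear (W : lmodType k) n (f : seq V -> W) :
  multilinear f -> linear (tpow_lift (n := n) f).
Proof.
elim: n f => [|n IH] f mf.
  by move=> c x y /=; rewrite scalerDl scalerA.
apply: tensor_lift_linear; split=> [y c u v|v].
  rewrite -tpow_lift_comb; apply: eq_tpow_lift => s.
  exact: (mf [::] s).
exact/IH/multilinear_cons.
Qed.

Lemma tpow_bilin (W : lmodType k) n (f : seq V -> W) : multilinear f ->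
  bilin (fun v (y : tpow n) => tpow_lift (fun s => f (v :: s)) y).
Proof.
move=> mf; split=> [y c u v|v].
  by rewrite -tpow_lift_comb; apply: eq_tpow_lift => s; apply: (mf [::] s).
exact/tpow_lift_linear/multilinear_cons.
Qed.

Lemma tpow_lift_ptens (W : lmodType k) (f : seq V -> W) s :
  multilinear f -> tpow_lift f (ptens s) = f s.
Proof.
elim: s f => [|v s IH] f mf /=; first exact: scale1r.
rewrite tensor_lift_tens; first by rewrite IH //; apply: multilinear_cons.
exact: tpow_bilin.
Qed.

Lemma tpow_ind (Q : forall n, tpow n -> Prop) :
  (forall n, Q n 0) ->
  (forall n c x y, Q n x -> Q n y -> Q n (c *: x + y)) ->
  (forall s, Q (size s) (ptens s)) -> forall n x, Q n x.
Proof.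
move=> Q0 QD Qp n; elim: n Q Q0 QD Qp => [|n IH] Q Q0 QD Qp x.
  have -> : x = x *: ptens [::] + 0 by rewrite addr0 -[LHS](mulr1 x).
  by apply: QD; [apply: (Qp [::]) | apply: Q0].
have [r ->] := tensor_sum x; elim: r => [|p r IHr].
  by rewrite big_nil; apply: Q0.
rewrite big_cons -[tens _ _]scale1r; apply: (QD n.+1 1) => //.
apply: (IH (fun n y => forall v, Q n.+1 (tens v y))) => [m v|m c u v Qu Qv w|s v].
- have -> : tens v (0 : tpow m) = 0 by apply: (lin0 ((tens_bilin _ _).2 v)).
  exact: Q0.
- by rewrite ((tens_bilin _ _).2 w); apply: QD.
- exact: (Qp (v :: s)).
Qed.

End TensorPower.

Section DirectSum.
Variables (k : comPzRingType) (M : nat -> lmodType k).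

Record dsum : Type := DSum {
  dsum_fun :> forall n, M n;
  dsum_finite : exists N, forall n, (N <= n)%N -> dsum_fun n = 0
}.

HB.instance Definition _ := gen_eqMixin dsum.
HB.instance Definition _ := gen_choiceMixin dsum.

Lemma dsumP (x y : dsum) : (forall n, x n = y n) -> x = y.
Proof.
case: x y => [x xP] [y yP] /= e.
have exy : x = y by apply: functional_extensionality_dep.
by case: y / exy yP e => yP _; congr DSum; apply: Prop_irrelevance.
Qed.

Fact dadd_subproof (x y : dsum) :
  exists N, forall n, (N <= n)%N -> x n + y n = 0.
Proof.
case: (dsum_finite x) (dsum_finite y) => [p xp] [q yq]; exists (maxn p q) => n.
by rewrite geq_max => /andP[pn qn]; rewrite xp // yq // addr0.
Qed.
Definition dadd (x y : dsum) := DSum (dadd_subproof x y).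

Fact dscl_subproof (c : k) (x : dsum) :
  exists N, forall n, (N <= n)%N -> c *: x n = 0.
Proof. by case: (dsum_finite x) => [p xp]; exists p => n pn; rewrite xp ?scaler0. Qed.
Definition dscl (c : k) (x : dsum) := DSum (dscl_subproof c x).

Fact dopp_subproof (x : dsum) : exists N, forall n, (N <= n)%N -> - x n = 0.
Proof. by case: (dsum_finite x) => [p xp]; exists p => n pn; rewrite xp ?oppr0. Qed.
Definition dopp (x : dsum) := DSum (dopp_subproof x).

Fact dzero_subproof : exists N, forall n, (N <= n)%N -> 0 = 0 :> M n.
Proof. by exists 0. Qed.
Definition dzero := DSum dzero_subproof.

Fact daddA : associative dadd.
Proof. by move=> x y z; apply: dsumP => n /=; rewrite addrA. Qed.
Fact daddC : commutative dadd.
Proof. by move=> x y; apply: dsumP => n /=; rewrite addrC. Qed.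
Fact dadd0 : left_id dzero dadd.
Proof. by move=> x; apply: dsumP => n /=; rewrite add0r. Qed.
Fact daddN : left_inverse dzero dopp dadd.
Proof. by move=> x; apply: dsumP => n /=; rewrite addNr. Qed.

HB.instance Definition _ := GRing.isZmodule.Build dsum daddA daddC dadd0 daddN.

Fact dsclA a b x : dscl a (dscl b x) = dscl (a * b) x.
Proof. by apply: dsumP => n /=; rewrite scalerA. Qed.
Fact dscl1 : left_id 1 dscl.
Proof. by move=> x; apply: dsumP => n /=; rewrite scale1r. Qed.
Fact dsclDr : right_distributive dscl +%R.
Proof. by move=> c x y; apply: dsumP => n /=; rewrite scalerDr. Qed.
Fact dsclDl x : {morph dscl^~ x : a b / a + b}.
Proof. by move=> a b; apply: dsumP => n /=; rewrite scalerDl. Qed.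

HB.instance Definition _ := GRing.Zmodule_isLmodule.Build k dsum
  dsclA dscl1 dsclDr dsclDl.

Fact dinj_subproof n (x : M n) :
  exists N, forall m, (N <= m)%N -> dfwith (fun m => 0 : M m) x m = 0.
Proof.
by exists n.+1 => m nm; rewrite dfwith_out //; move: nm; case: ltngtP.
Qed.
Definition dinj n (x : M n) : dsum := DSum (dinj_subproof x).

Lemma dinj_eq n (x : M n) : dinj x n = x.
Proof. exact: dfwith_in. Qed.

Lemma dinj_neq n m (x : M n) : n != m -> dinj x m = 0.
Proof. exact: dfwith_out. Qed.

Lemma dinj_linear n : linear (@dinj n).
Proof.
move=> c x y; apply: dsumP => m /=; case: (eqVneq n m) => [<-|nm].
  by rewrite !dfwith_in.
by rewrite !dfwith_out // scaler0 addr0.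
Qed.

Definition dsum_lift (W : lmodType k) (f : forall n, M n -> W) (x : dsum) : W :=
  \sum_(n < sval (cid (dsum_finite x))) f n (x n).

Lemma dsum_liftE (W : lmodType k) (f : forall n, M n -> W) (x : dsum) N :
  (forall n, f n 0 = 0) -> (forall n, (N <= n)%N -> x n = 0) ->
  dsum_lift f x = \sum_(n < N) f n (x n).
Proof.
move=> f0 xN; rewrite /dsum_lift; case: cid => p /= xp.
wlog le_pN : p N xN xp / (p <= N)%N.
  by move=> H; case: (leqP p N) => [/H->//|/ltnW/H->].
rewrite -!(big_mkord xpredT (fun n => f n (x n))) (big_cat_nat _ le_pN) //=.
rewrite [X in _ = _ + X]big_nat_cond [X in _ = _ + X]big1 ?addr0 //.
by move=> n /andP[/andP[pn _] _]; rewrite xp // f0.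
Qed.

Lemma dsum_lift_linear (W : lmodType k) (f : forall n, M n -> W) :
  (forall n, linear (f n)) -> linear (dsum_lift f).
Proof.
move=> lf c x y; have f0 n := lin0 (lf n).
case: (dsum_finite x) (dsum_finite y) => [p xp] [q yq].
rewrite (@dsum_liftE _ _ x (maxn p q)) //; last first.
  by move=> n; rewrite geq_max => /andP[pn qn]; apply: xp.
rewrite (@dsum_liftE _ _ y (maxn p q)) //; last first.
  by move=> n; rewrite geq_max => /andP[pn qn]; apply: yq.
rewrite (@dsum_liftE _ _ _ (maxn p q)) //; last first.
  move=> n; rewrite geq_max => /andP[pn qn].
  change (c *: x n + y n = 0).
  by rewrite xp // yq // scaler0 addr0.
rewrite scaler_sumr -big_split; apply: eq_bigr => n _; exact: lf.
Qed.

Lemma dsum_lift_inj (W : lmodType k) (f : forall n, M n -> W) n (x : M n) :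
  (forall n, f n 0 = 0) -> dsum_lift f (dinj x) = f n x.
Proof.
move=> f0; rewrite (@dsum_liftE _ _ _ n.+1) //; last first.
  by move=> m nm; apply: dinj_neq; move: nm; case: ltngtP.
rewrite big_ord_recr /= big1 ?add0r; first by rewrite dfwith_in.
by move=> i _; rewrite dfwith_out ?f0 // neq_ltn ltn_ord orbT.
Qed.

Lemma dsum_lift_comb (W : lmodType k) (f g : forall n, M n -> W) c x :
  dsum_lift (fun n y => c *: f n y + g n y) x =
  c *: dsum_lift f x + dsum_lift g x.
Proof. by rewrite /dsum_lift big_split scaler_sumr. Qed.

Lemma eq_dsum_lift (W : lmodType k) (f g : forall n, M n -> W) :
  (forall n, f n =1 g n) -> dsum_lift f =1 dsum_lift g.
Proof. by move=> e x; apply: eq_bigr => n _; apply: e. Qed.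

Lemma dsum_ind' (Q : dsum -> Prop) :
  Q 0 -> (forall c x y, Q x -> Q y -> Q (c *: x + y)) ->
  (forall n (x : M n), Q (dinj x)) -> forall x, Q x.
Proof.
move=> Q0 QD Qi x.
have -> : x = dsum_lift dinj x.
  have d0 n : @dinj n 0 = 0 := lin0 (@dinj_linear n).
  apply: dsumP => m; case: (dsum_finite x) => N xN.
  rewrite (@dsum_liftE _ _ _ (maxn N m.+1)) //; last first.
    by move=> n; rewrite geq_max => /andP[/xN].
  have ev : linear (fun y : dsum => y m) by [].
  rewrite (lin_sum ev) (bigD1 (Ordinal (leq_maxr N m.+1))) //=.
  rewrite dfwith_in big1 ?addr0 // => i /eqP ne.
  by rewrite dfwith_out //; apply/eqP => e; apply: ne; apply: val_inj.
rewrite /dsum_lift; elim/big_ind: _ => // [y z Qy Qz].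
by rewrite -[y]scale1r; apply: QD.
Qed.

End DirectSum.

Section SubmoduleType.
Variables (k : pzRingType) (L : lmodType k) (V : submodClosed L).

Definition submod_type : Type := {x : L | x \in V}.
HB.instance Definition _ := SubChoice.on submod_type.
HB.instance Definition _ := [SubChoice_isSubLmodule of submod_type by <:].

End SubmoduleType.

(* The interleavings of two words, listed with multiplicity: one for each
   (size s, size t)-shuffle. *)
Fixpoint shuffles (T : Type) (s : seq T) : seq T -> seq (seq T) :=
  fix shuffles_s (t : seq T) : seq (seq T) :=
    match s, t with
    | [::], _ => [:: t]
    | _, [::] => [:: s]
    | x :: s', y :: t' =>
        [seq x :: u | u <- shuffles s' t] ++ [seq y :: u | u <- shuffles_s t']
    end.

Lemma size_shuffles (T : Type) (s t : seq T) :
  size (shuffles s t) = 'C(size s + size t, size s).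
Proof.
elim: s t => [|x s IHs] t; first by case: t => [|y t] /=; rewrite bin0.
elim: t => [|y t IHt]; first by rewrite /= addn0 binn.
rewrite [LHS]size_cat !size_map IHs IHt [size (y :: t)]/= [size (x :: s)]/=.
by rewrite addSn [in RHS]addSn binS addnC addnS.
Qed.

Section ShuffleSums.
Variables (k : comPzRingType) (V W : lmodType k).
Implicit Types (F : seq V -> W) (s t r : seq V).

Definition shsum F s t : W := \sum_(u <- shuffles s t) F u.

Lemma shsum0l F t : shsum F [::] t = F t.
Proof. by case: t => [|y t]; rewrite /shsum /= big_seq1. Qed.

Lemma shsum0r F s : shsum F s [::] = F s.
Proof. by case: s => [|y s]; rewrite /shsum /= big_seq1. Qed.

Lemma shsum_cons F x s y t : shsum F (x :: s) (y :: t) =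
  shsum (fun u => F (x :: u)) s (y :: t) + shsum (fun u => F (y :: u)) (x :: s) t.
Proof. by rewrite /shsum big_cat !big_map. Qed.

Lemma shsum_comb c F G s t :
  shsum (fun u => c *: F u + G u) s t = c *: shsum F s t + shsum G s t.
Proof. by rewrite /shsum big_split scaler_sumr. Qed.

Lemma eq_shsum F G s t : F =1 G -> shsum F s t = shsum G s t.
Proof. by move=> e; apply: eq_bigr => u _; apply: e. Qed.

Lemma shsumC F s t : shsum F s t = shsum F t s.
Proof.
elim: s F t => [|x s IHs] F t; first by rewrite shsum0l shsum0r.
elim: t F => [|y t IHt] F; first by rewrite shsum0l shsum0r.
by rewrite !shsum_cons IHs IHt addrC.
Qed.

Lemma shsumA F s t r :
  shsum (fun u => shsum F u r) s t = shsum (fun u => shsum F s u) t r.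
Proof.
elim: s F t r => [|x s IHs] F t r.
  by rewrite shsum0l; apply: eq_shsum => u; rewrite shsum0l.
elim: t F r => [|y t IHt] F r; first by rewrite shsum0r shsum0l.
elim: r F => [|z r IHr] F.
  by rewrite shsum0r; apply: eq_shsum => u; rewrite shsum0r.
have split2 a b F' (p q : seq V) :
  shsum (fun u => shsum F' (a :: u) (b :: r)) p q
  = shsum (fun u => shsum (fun w => F' (a :: w)) u (b :: r)) p q
    + shsum (fun u => shsum (fun w => F' (b :: w)) (a :: u) r) p q.
  rewrite -[X in X + _]scale1r -shsum_comb; apply: eq_shsum => u.
  by rewrite scale1r shsum_cons.
have split3 b F' (p q : seq V) :
  shsum (fun u => shsum F' (x :: s) (b :: u)) p q
  = shsum (fun u => shsum (fun w => F' (x :: w)) s (b :: u)) p q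
    + shsum (fun u => shsum (fun w => F' (b :: w)) (x :: s) u) p q.
  rewrite -[X in X + _]scale1r -shsum_comb; apply: eq_shsum => u.
  by rewrite scale1r shsum_cons.
rewrite shsum_cons !split2 IHs (IHt (fun w => F (y :: w))).
rewrite [RHS]shsum_cons !split3 -(IHr (fun w => F (z :: w))).
rewrite (shsum_cons (fun u => shsum (fun w => F (z :: w)) u r)).
rewrite (shsum_cons (fun u => shsum (fun w => F (x :: w)) s u)).
by rewrite addrACA [X in X + _]addrAC -!addrA.
Qed.

Lemma shsum_multilinear_l F t : multilinear F -> multilinear (shsum F ^~ t).
Proof.
move=> mF s1; elim: s1 F t mF => [|x s1 IHs] F t mF s2.
  elim: t F mF => [|y t IHt] F mF c u v /=; first by rewrite !shsum0r (mF [::]).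
  rewrite !shsum_cons (IHt _ (multilinear_cons y mF)) scalerDr addrACA.
  by congr (_ + _); rewrite -shsum_comb; apply: eq_shsum => w; rewrite (mF [::]).
elim: t F mF => [|y t IHt] F mF c u v /=.
  by rewrite !shsum0r (mF (x :: s1)).
rewrite !shsum_cons (IHt _ (multilinear_cons y mF)).
by rewrite (IHs _ _ (multilinear_cons x mF)) scalerDr addrACA.
Qed.

Lemma shsum_multilinear_r F s : multilinear F -> multilinear (shsum F s).
Proof.
move=> mF s1 s2 c u v; rewrite !(shsumC F s).
exact: (shsum_multilinear_l s mF s1 s2).
Qed.

End ShuffleSums.

Section ShuffleAlgebra.
Variables (k : comPzRingType) (V : lmodType k).

(* The direct sum of all tensor powers of V; [word [:: v1; ..; vn]] is the pure
   tensor v1 (x) .. (x) vn. *)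
Definition shuffle_type : Type := dsum (tpow V).
HB.instance Definition _ := GRing.Lmodule.on shuffle_type.

Definition word (s : seq V) : shuffle_type := dinj (ptens s).

Definition shuffle_lift (W : lmodType k) (f : seq V -> W) (x : shuffle_type) : W :=
  dsum_lift (fun n => tpow_lift (n := n) f) x.

Definition shuffle_mul (x y : shuffle_type) : shuffle_type :=
  shuffle_lift (fun s => shuffle_lift (fun t =>
    \sum_(u <- shuffles s t) word u) y) x.

Lemma shuffle_lift_linear (W : lmodType k) (f : seq V -> W) :
  multilinear f -> linear (shuffle_lift f).
Proof. by move=> mf; apply: dsum_lift_linear => n; apply: tpow_lift_linear. Qed.

Lemma shuffle_lift_word (W : lmodType k) (f : seq V -> W) s :
  multilinear f -> shuffle_lift f (word s) = f s.
Proof.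
move=> mf; rewrite /shuffle_lift dsum_lift_inj; first exact: tpow_lift_ptens.
by move=> n; apply: lin0; apply: tpow_lift_linear.
Qed.

Lemma shuffle_lift_comb (W : lmodType k) c (f g : seq V -> W) x :
  shuffle_lift (fun s => c *: f s + g s) x =
  c *: shuffle_lift f x + shuffle_lift g x.
Proof.
rewrite -dsum_lift_comb; apply: eq_dsum_lift => n y; exact: tpow_lift_comb.
Qed.

Lemma eq_shuffle_lift (W : lmodType k) (f g : seq V -> W) :
  f =1 g -> shuffle_lift f =1 shuffle_lift g.
Proof. by move=> e; apply: eq_dsum_lift => n; apply: eq_tpow_lift. Qed.

Lemma shuffle_ind (Q : shuffle_type -> Prop) :
  Q 0 -> (forall c x y, Q x -> Q y -> Q (c *: x + y)) ->
  (forall s, Q (word s)) -> forall x, Q x.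
Proof.
move=> Q0 QD Qw; apply: dsum_ind' => // n x.
apply: (tpow_ind (Q := fun n y => Q (dinj y))) x => // [m|m c x y Qx Qy].
  by rewrite (lin0 (@dinj_linear _ _ _)).
by rewrite dinj_linear; apply: QD.
Qed.

Definition shuffle_cons (v : V) (x : shuffle_type) : shuffle_type :=
  dsum_lift (fun n (y : tpow V n) => dinj (n := n.+1) (tens v y)) x.

Lemma shuffle_cons_linear v : linear (shuffle_cons v).
Proof.
apply: dsum_lift_linear => n c x y.
by rewrite ((tens_bilin _ _).2 v) dinj_linear.
Qed.

Lemma shuffle_cons_word v s : shuffle_cons v (word s) = word (v :: s).
Proof.
rewrite /shuffle_cons dsum_lift_inj // => n.
by rewrite (lin0 ((tens_bilin _ _).2 v)) (lin0 (@dinj_linear _ _ _)).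
Qed.

Lemma word_multilinear : multilinear word.
Proof.
elim=> [|w s1 IH] s2 c u v /=; last first.
  by rewrite -!shuffle_cons_word IH shuffle_cons_linear.
rewrite -!shuffle_cons_word /shuffle_cons -dsum_lift_comb.
apply: eq_dsum_lift => n y.
by rewrite ((tens_bilin _ _).1 y) (@dinj_linear _ (tpow V) n.+1).
Qed.

Lemma shuffle_mul_linear_r x : linear (shuffle_mul x).
Proof.
move=> c y z; rewrite /shuffle_mul -shuffle_lift_comb.
apply: eq_shuffle_lift => s.
by rewrite shuffle_lift_linear //; apply/shsum_multilinear_r/word_multilinear.
Qed.

Lemma shuffle_mul_multilinear y :
  multilinear (fun s => shuffle_lift (shsum word s) y).
Proof.
move=> s1 s2 c u v; rewrite -shuffle_lift_comb; apply: eq_shuffle_lift => t.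
exact: (shsum_multilinear_l t word_multilinear s1 s2).
Qed.

Lemma shuffle_mul_linear_l y : linear (shuffle_mul ^~ y).
Proof. exact/shuffle_lift_linear/shuffle_mul_multilinear. Qed.

Lemma shuffle_mul_word s t :
  shuffle_mul (word s) (word t) = \sum_(u <- shuffles s t) word u.
Proof.
rewrite /shuffle_mul shuffle_lift_word; last exact: shuffle_mul_multilinear.
by rewrite shuffle_lift_word //; apply/shsum_multilinear_r/word_multilinear.
Qed.

Fact shuffle_mulC : commutative shuffle_mul.
Proof.
move=> x y; elim/shuffle_ind: x => [|c x1 x2 e1 e2|s].
- by rewrite (lin0 (shuffle_mul_linear_l y)) (lin0 (shuffle_mul_linear_r y)).
- by rewrite shuffle_mul_linear_l shuffle_mul_linear_r e1 e2.
elim/shuffle_ind: y => [|c x1 x2 e1 e2|t].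
- by rewrite (lin0 (shuffle_mul_linear_l _)) (lin0 (shuffle_mul_linear_r _)).
- by rewrite shuffle_mul_linear_l shuffle_mul_linear_r e1 e2.
by rewrite !shuffle_mul_word; apply: shsumC.
Qed.

Fact shuffle_mulA : associative shuffle_mul.
Proof.
have l0 y : shuffle_mul 0 y = 0 := lin0 (shuffle_mul_linear_l y).
have r0 y : shuffle_mul y 0 = 0 := lin0 (shuffle_mul_linear_r y).
move=> x y z; elim/shuffle_ind: x => [|c x1 x2 e1 e2|s]; first by rewrite !l0.
  by rewrite !shuffle_mul_linear_l e1 e2.
elim/shuffle_ind: y => [|c x1 x2 e1 e2|t]; first by rewrite !l0 !r0 !l0.
  by rewrite shuffle_mul_linear_l !shuffle_mul_linear_r shuffle_mul_linear_l e1 e2.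
elim/shuffle_ind: z => [|c x1 x2 e1 e2|r]; first by rewrite !r0.
  by rewrite !shuffle_mul_linear_r e1 e2.
rewrite !shuffle_mul_word (lin_sum (shuffle_mul_linear_l _)).
rewrite (lin_sum (shuffle_mul_linear_r _)).
under eq_bigr do rewrite shuffle_mul_word.
under [RHS]eq_bigr do rewrite shuffle_mul_word.
by symmetry; apply: (shsumA word s t r).
Qed.

Fact shuffle_mul1 : left_id (word [::]) shuffle_mul.
Proof.
elim/shuffle_ind => [|c x1 x2 e1 e2|s].
- exact: (lin0 (shuffle_mul_linear_r _)).
- by rewrite shuffle_mul_linear_r e1 e2.
by rewrite shuffle_mul_word; apply: (shsum0l word).
Qed.

Fact shuffle_mulDl : left_distributive shuffle_mul +%R.
Proof. by move=> x y z; rewrite (lin_add (shuffle_mul_linear_l z)). Qed.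

HB.instance Definition _ := GRing.Zmodule_isComPzRing.Build shuffle_type
  shuffle_mulA shuffle_mulC shuffle_mul1 shuffle_mulDl.

Fact shuffle_scalerAl (c : k) (x y : shuffle_type) : c *: (x * y) = (c *: x) * y.
Proof. by symmetry; apply: (lin_scale (shuffle_mul_linear_l y)). Qed.

HB.instance Definition _ := ComPzRing_isAlgebra.Build k shuffle_type
  (@scalerA _ shuffle_type) (@scale1r _ shuffle_type) (@scalerDr _ shuffle_type)
  (@scalerDl _ shuffle_type) shuffle_scalerAl.

Definition shuffle_alg : comPzAlgType k := shuffle_type.

Lemma wordM s t :
  (word s : shuffle_alg) * word t = \sum_(u <- shuffles s t) (word u : shuffle_alg).
Proof. exact: shuffle_mul_word. Qed.

End ShuffleAlgebra.

Section TensorAlgebra.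
Variables (k : comPzRingType) (A B : comPzAlgType k).

Definition tensor_type : Type := tensor A B.
HB.instance Definition _ := GRing.Lmodule.on tensor_type.

Definition tensor_mul (x y : tensor_type) : tensor_type :=
  tensor_lift (fun (a : A) (b : B) =>
    tensor_lift (fun (c : A) (d : B) => tens (a * c) (b * d)) y) x.

Lemma tensor_mul_bilin_r a b :
  bilin (fun (c : A) (d : B) => tens (a * c) (b * d)).
Proof.
split=> [d|c] r u v; rewrite mulrDr -pzscalerAr.
  exact: (tens_bilin _ _).1.
exact: (tens_bilin _ _).2.
Qed.

Lemma tensor_mul_bilin_l (y : tensor_type) :
  bilin (fun (a : A) (b : B) =>
    tensor_lift (fun (c : A) (d : B) => tens (a * c) (b * d)) y).
Proof.
split=> [b|a] r u v; rewrite -tensor_lift_comb; apply: eq_tensor_lift => c d.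
  by rewrite mulrDl -pzscalerAl; apply: (tens_bilin _ _).1.
by rewrite mulrDl -pzscalerAl; apply: (tens_bilin _ _).2.
Qed.

Lemma tensor_mul_linear_l y : linear (tensor_mul ^~ y).
Proof. exact/tensor_lift_linear/tensor_mul_bilin_l. Qed.

Lemma tensor_mul_linear_r x : linear (tensor_mul x).
Proof.
move=> c y z; rewrite /tensor_mul -tensor_lift_comb.
apply: eq_tensor_lift => a b.
by rewrite tensor_lift_linear //; apply: tensor_mul_bilin_r.
Qed.

Lemma tensor_mul_tens a b c d :
  tensor_mul (tens a b) (tens c d) = tens (a * c) (b * d).
Proof.
rewrite /tensor_mul tensor_lift_tens; last exact: tensor_mul_bilin_l.
by rewrite tensor_lift_tens //; apply: tensor_mul_bilin_r.
Qed.

Lemma tensor_ind' (Q : tensor_type -> Prop) :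
  Q 0 -> (forall c x y, Q x -> Q y -> Q (c *: x + y)) ->
  (forall a b, Q (tens a b)) -> forall x, Q x.
Proof.
move=> Q0 QD Qt x; have [r ->] := tensor_sum x.
elim/big_ind: _ => // [y z Qy Qz].
by rewrite -[y]scale1r; apply: QD.
Qed.

Fact tensor_mulC : commutative tensor_mul.
Proof.
move=> x y; elim/tensor_ind': x => [|c x1 x2 e1 e2|a b].
- by rewrite (lin0 (tensor_mul_linear_l y)) (lin0 (tensor_mul_linear_r y)).
- by rewrite tensor_mul_linear_l tensor_mul_linear_r e1 e2.
elim/tensor_ind': y => [|c x1 x2 e1 e2|c d].
- by rewrite (lin0 (tensor_mul_linear_l _)) (lin0 (tensor_mul_linear_r _)).
- by rewrite tensor_mul_linear_l tensor_mul_linear_r e1 e2.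
by rewrite !tensor_mul_tens mulrC [b * d]mulrC.
Qed.

Fact tensor_mulA : associative tensor_mul.
Proof.
have l0 y : tensor_mul 0 y = 0 := lin0 (tensor_mul_linear_l y).
have r0 y : tensor_mul y 0 = 0 := lin0 (tensor_mul_linear_r y).
move=> x y z; elim/tensor_ind': x => [|c x1 x2 e1 e2|a b]; first by rewrite !l0.
  by rewrite !tensor_mul_linear_l e1 e2.
elim/tensor_ind': y => [|c x1 x2 e1 e2|c d]; first by rewrite !l0 !r0 !l0.
  by rewrite tensor_mul_linear_l !tensor_mul_linear_r tensor_mul_linear_l e1 e2.
elim/tensor_ind': z => [|r x1 x2 e1 e2|e f]; first by rewrite !r0.
  by rewrite !tensor_mul_linear_r e1 e2.
by rewrite !tensor_mul_tens !mulrA.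
Qed.

Fact tensor_mul1 : left_id (tens (1 : A) (1 : B) : tensor_type) tensor_mul.
Proof.
elim/tensor_ind' => [|c x1 x2 e1 e2|a b].
- exact: (lin0 (tensor_mul_linear_r _)).
- by rewrite tensor_mul_linear_r e1 e2.
by rewrite tensor_mul_tens !mul1r.
Qed.

Fact tensor_mulDl : left_distributive tensor_mul +%R.
Proof. by move=> x y z; rewrite (lin_add (tensor_mul_linear_l z)). Qed.

HB.instance Definition _ := GRing.Zmodule_isComPzRing.Build tensor_type
  tensor_mulA tensor_mulC tensor_mul1 tensor_mulDl.

Fact tensor_scalerAl (c : k) (x y : tensor_type) : c *: (x * y) = (c *: x) * y.
Proof. by symmetry; apply: (lin_scale (tensor_mul_linear_l y)). Qed.

HB.instance Definition _ := ComPzRing_isAlgebra.Build k tensor_type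
  (@scalerA _ tensor_type) (@scale1r _ tensor_type) (@scalerDr _ tensor_type)
  (@scalerDl _ tensor_type) tensor_scalerAl.

Definition tensor_alg : comPzAlgType k := tensor_type.

End TensorAlgebra.

Section ExtendedShuffle.
Variables (k : comPzRingType) (L : comPzAlgType k) (V : lmodType k).

(* Degree 0 is L itself, degree n >= 1 is L (x) V^(x)n. *)
Definition ext_comp (n : nat) : lmodType k :=
  if n is n'.+1 then tensor L (tpow V n'.+1) else L.

Definition ext_type : Type := dsum ext_comp.
HB.instance Definition _ := GRing.Lmodule.on ext_type.

Definition ext_tens (a : L) (s : seq V) : ext_comp (size s) :=
  match s return ext_comp (size s) with
  | [::] => a
  | v :: s' => tens a (ptens (v :: s'))
  end.

Definition ext_word (a : L) (s : seq V) : ext_type := dinj (ext_tens a s).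

Definition ext_comp_lift (W : lmodType k) (f : L -> seq V -> W) (n : nat) :
    ext_comp n -> W :=
  match n return ext_comp n -> W with
  | 0 => fun a => f a [::]
  | n'.+1 => tensor_lift (fun a => tpow_lift (n := n'.+1) (f a))
  end.

Definition ext_lift (W : lmodType k) (f : L -> seq V -> W) (x : ext_type) : W :=
  dsum_lift (ext_comp_lift f) x.

Definition ext_mul (x y : ext_type) : ext_type :=
  ext_lift (fun a s => ext_lift (fun b t =>
    \sum_(u <- shuffles s t) ext_word (a * b) u) y) x.

Definition ext_multilinear (W : lmodType k) (f : L -> seq V -> W) : Prop :=
  (forall s, linear (f ^~ s)) /\ (forall a, multilinear (f a)).

Lemma ext_comp_bilin (W : lmodType k) (f : L -> seq V -> W) n :
  ext_multilinear f -> bilin (fun a => tpow_lift (n := n) (f a)).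
Proof.
move=> [lf mf]; split=> [y c a b|a]; last exact: tpow_lift_linear.
by rewrite -tpow_lift_comb; apply: eq_tpow_lift => s; apply: lf.
Qed.

Lemma ext_comp_lift_linear (W : lmodType k) (f : L -> seq V -> W) n :
  ext_multilinear f -> linear (ext_comp_lift f (n := n)).
Proof.
move=> mf; case: n => [|n] /=; first exact: mf.1.
exact: (tensor_lift_linear (ext_comp_bilin n.+1 mf)).
Qed.

Lemma ext_lift_linear (W : lmodType k) (f : L -> seq V -> W) :
  ext_multilinear f -> linear (ext_lift f).
Proof. by move=> mf; apply: dsum_lift_linear => n; apply: ext_comp_lift_linear. Qed.

Lemma ext_lift_word (W : lmodType k) (f : L -> seq V -> W) a s :
  ext_multilinear f -> ext_lift f (ext_word a s) = f a s.
Proof.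
move=> mf; rewrite /ext_lift dsum_lift_inj; last first.
  by move=> n; apply: lin0; apply: ext_comp_lift_linear.
case: s => [|v s] //; rewrite [LHS]tensor_lift_tens; last first.
  exact: (ext_comp_bilin (size s).+1 mf).
by rewrite (@tpow_lift_ptens _ _ _ (f a) (v :: s)) //; apply: mf.2.
Qed.

Lemma ext_lift_comb (W : lmodType k) c (f g : L -> seq V -> W) x :
  ext_lift (fun a s => c *: f a s + g a s) x = c *: ext_lift f x + ext_lift g x.
Proof.
rewrite -dsum_lift_comb; apply: eq_dsum_lift => -[|n] y //=.
rewrite -tensor_lift_comb; apply: eq_tensor_lift => a z.
exact: (@tpow_lift_comb _ _ _ n.+1).
Qed.

Lemma eq_ext_lift (W : lmodType k) (f g : L -> seq V -> W) :
  f =2 g -> ext_lift f =1 ext_lift g.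
Proof.
move=> e; apply: eq_dsum_lift => -[|n] y; first exact: e.
by apply: eq_tensor_lift => a; apply: (@eq_tpow_lift _ _ _ n.+1); apply: e.
Qed.

Lemma ext_ind (Q : ext_type -> Prop) :
  Q 0 -> (forall c x y, Q x -> Q y -> Q (c *: x + y)) ->
  (forall a s, Q (ext_word a s)) -> forall x, Q x.
Proof.
move=> Q0 QD Qw; apply: dsum_ind' => // -[|n] x; first exact: (Qw x [::]).
have i0 : @dinj k ext_comp n.+1 0 = 0 := lin0 (@dinj_linear _ ext_comp n.+1).
have [r ->] := tensor_sum x; elim: r => [|p r IHr]; first by rewrite big_nil i0.
rewrite big_cons -[tens _ _]scale1r (@dinj_linear _ ext_comp n.+1).
apply: (QD 1) => //; case: p => a y /=.
pose Q' n (y : tpow V n) : Prop :=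
  match n return tpow V n -> Prop with
  | 0 => fun _ => True
  | n'.+1 => fun y => Q (@dinj k ext_comp n'.+1 (tens a y))
  end y.
apply: (tpow_ind (Q := Q')) y => [[|m]|[|m] c u v|[|v s]] //=.
- rewrite (lin0 ((tens_bilin _ _).2 a)).
  by rewrite (lin0 (@dinj_linear _ ext_comp m.+1)).
- move=> Qu Qv; rewrite ((tens_bilin _ _).2 a) (@dinj_linear _ ext_comp m.+1).
  exact: QD.
- exact: (Qw a (v :: s)).
Qed.

Definition ext_shift (a : L) (x : shuffle_type V) : ext_type :=
  dsum_lift (fun n => match n return tpow V n -> ext_type with
    | 0 => fun c : k^o => @dinj k ext_comp 0 ((c : k) *: a)
    | n'.+1 => fun y => @dinj k ext_comp n'.+1 (tens a y)
    end) x.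

Lemma ext_shift_linear a : linear (ext_shift a).
Proof.
apply: dsum_lift_linear => -[|n] c x y.
  by rewrite scalerDl -(@dinj_linear _ ext_comp 0) -scalerA.
by rewrite ((tens_bilin _ _).2 a) (@dinj_linear _ ext_comp n.+1).
Qed.

Lemma ext_shift_word a s : ext_shift a (word s) = ext_word a s.
Proof.
rewrite /ext_shift dsum_lift_inj.
  by case: s => [|v s] //=; rewrite scale1r.
case=> [|n]; first by rewrite scale0r (lin0 (@dinj_linear _ ext_comp 0)).
rewrite (lin0 ((tens_bilin _ _).2 a)).
by rewrite (lin0 (@dinj_linear _ ext_comp n.+1)).
Qed.

Lemma ext_word_multilinear : ext_multilinear ext_word.
Proof.
split=> [[|v s] c a b|a s1 s2 c u v].
- exact: (@dinj_linear _ ext_comp 0).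
- rewrite /ext_word /= ((tens_bilin _ _).1 _).
  exact: (@dinj_linear _ ext_comp (size s).+1).
by rewrite -!ext_shift_word word_multilinear ext_shift_linear.
Qed.

Lemma ext_mul_multilinear_r a s : ext_multilinear (fun b t =>
  \sum_(u <- shuffles s t) ext_word (a * b) u).
Proof.
split=> [t c b b'|b]; last first.
  exact: (shsum_multilinear_r s (ext_word_multilinear.2 _)).
rewrite -shsum_comb; apply: eq_shsum => u.
by rewrite mulrDr -pzscalerAr ext_word_multilinear.1.
Qed.

Lemma ext_mul_multilinear_l y : ext_multilinear (fun a s => ext_lift (fun b t =>
  \sum_(u <- shuffles s t) ext_word (a * b) u) y).
Proof.
split=> [s c a a'|a s1 s2 c u v]; rewrite -ext_lift_comb;
  apply: eq_ext_lift => b t.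
  rewrite -shsum_comb; apply: eq_shsum => w.
  by rewrite mulrDl -pzscalerAl ext_word_multilinear.1.
exact: (shsum_multilinear_l t (ext_word_multilinear.2 _) s1 s2).
Qed.

Lemma ext_mul_linear_l y : linear (ext_mul ^~ y).
Proof. exact/ext_lift_linear/ext_mul_multilinear_l. Qed.

Lemma ext_mul_linear_r x : linear (ext_mul x).
Proof.
move=> c y z; rewrite /ext_mul -ext_lift_comb; apply: eq_ext_lift => a s.
by rewrite ext_lift_linear //; apply: ext_mul_multilinear_r.
Qed.

Lemma ext_mul_word a s b t : ext_mul (ext_word a s) (ext_word b t) =
  \sum_(u <- shuffles s t) ext_word (a * b) u.
Proof.
rewrite /ext_mul ext_lift_word; last exact: ext_mul_multilinear_l.
by rewrite ext_lift_word //; apply: ext_mul_multilinear_r.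
Qed.

Fact ext_mulC : commutative ext_mul.
Proof.
move=> x y; elim/ext_ind: x => [|c x1 x2 e1 e2|a s].
- by rewrite (lin0 (ext_mul_linear_l y)) (lin0 (ext_mul_linear_r y)).
- by rewrite ext_mul_linear_l ext_mul_linear_r e1 e2.
elim/ext_ind: y => [|c x1 x2 e1 e2|b t].
- by rewrite (lin0 (ext_mul_linear_l _)) (lin0 (ext_mul_linear_r _)).
- by rewrite ext_mul_linear_l ext_mul_linear_r e1 e2.
by rewrite !ext_mul_word mulrC; apply: (shsumC (ext_word (b * a))).
Qed.

Fact ext_mulA : associative ext_mul.
Proof.
have l0 y : ext_mul 0 y = 0 := lin0 (ext_mul_linear_l y).
have r0 y : ext_mul y 0 = 0 := lin0 (ext_mul_linear_r y).
move=> x y z; elim/ext_ind: x => [|c x1 x2 e1 e2|a s]; first by rewrite !l0.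
  by rewrite !ext_mul_linear_l e1 e2.
elim/ext_ind: y => [|c x1 x2 e1 e2|b t]; first by rewrite !l0 !r0 !l0.
  by rewrite ext_mul_linear_l !ext_mul_linear_r ext_mul_linear_l e1 e2.
elim/ext_ind: z => [|c x1 x2 e1 e2|d r]; first by rewrite !r0.
  by rewrite !ext_mul_linear_r e1 e2.
rewrite !ext_mul_word (lin_sum (ext_mul_linear_l _)).
rewrite (lin_sum (ext_mul_linear_r _)).
under eq_bigr do rewrite ext_mul_word mulrA.
under [RHS]eq_bigr do rewrite ext_mul_word.
by symmetry; apply: (shsumA (ext_word (a * b * d)) s t r).
Qed.

Fact ext_mul1 : left_id (ext_word 1 [::]) ext_mul.
Proof.
elim/ext_ind => [|c x1 x2 e1 e2|a s].
- exact: (lin0 (ext_mul_linear_r _)).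
- by rewrite ext_mul_linear_r e1 e2.
by rewrite ext_mul_word mul1r; apply: (shsum0l (ext_word a)).
Qed.

Fact ext_mulDl : left_distributive ext_mul +%R.
Proof. by move=> x y z; rewrite (lin_add (ext_mul_linear_l z)). Qed.

HB.instance Definition _ := GRing.Zmodule_isComPzRing.Build ext_type
  ext_mulA ext_mulC ext_mul1 ext_mulDl.

Fact ext_scalerAl (c : k) (x y : ext_type) : c *: (x * y) = (c *: x) * y.
Proof. by symmetry; apply: (lin_scale (ext_mul_linear_l y)). Qed.

HB.instance Definition _ := ComPzRing_isAlgebra.Build k ext_type
  (@scalerA _ ext_type) (@scale1r _ ext_type) (@scalerDr _ ext_type)
  (@scalerDl _ ext_type) ext_scalerAl.

Definition ext_shuffle_alg : comPzAlgType k := ext_type.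

Lemma ext_wordM a s b t : (ext_word a s : ext_shuffle_alg) * ext_word b t =
  \sum_(u <- shuffles s t) (ext_word (a * b) u : ext_shuffle_alg).
Proof. exact: ext_mul_word. Qed.

End ExtendedShuffle.

Definition direct_sum (k : pzRingType) (L : lmodType k) (U W : L -> Prop) : Prop :=
  forall x, exists! p : L * L, [/\ U p.1, W p.2 & x = p.1 + p.2].

(* The operator of A induces one on the image of A in its localization.  This is
   automatic when A -> S^-1 A is injective but not in general, and the
   canonical map to a Rota-Baxter localization containing S^-1 A can commute with
   the operators only in this case. *)
Definition descends_to_image (k : pzRingType) (A : comPzAlgType k)
    (S : mulrClosed A) (P : A -> A) : Prop :=
  forall a, loc_map S a = 0 :> localization S ->
    loc_map S (P a) = 0 :> localization S.

Section Candidates.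
Variables (k : comPzRingType) (A : comPzAlgType k) (S : mulrClosed A).
Variable V : submodClosed (localization S).

Definition rb_ext : comPzAlgType k :=
  ext_shuffle_alg (localization S) (submod_type V).

Definition rb_tensor : comPzAlgType k :=
  tensor_alg (localization S) (shuffle_alg (submod_type V)).

Definition to_ext (a : A) : rb_ext := ext_word (loc_map S a) [::].

Definition to_tensor (a : A) : rb_tensor :=
  tens (loc_map S a : localization S) (1 : shuffle_alg (submod_type V)).

End Candidates.

(* Main.v *)
Require Import Defs.
From mathcomp Require Import all_boot all_algebra.
From mathcomp Require Import ring.
From mathcomp Require Import boolp.
Import GRing.Theory.
Local Open Scope ring_scope.

Set Implicit Arguments.
Unset Strict Implicit.
Unset Printing Implicit Defensive.

(** Write L for S^-1 A and Abar for the image of A in L, so that L = Abar + V.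
    Since [P] descends to Abar, a Rota-Baxter algebra over L only lacks
    integrals of the elements of V; adjoining them freely produces iterated
    integrals, and the product of iterated integrals is the shuffle product.

    A word (l; v1 .. vn) stands for l * Q (v1 * Q (v2 * .. Q vn)).  This reading
    forces the operator Q.  On v in V, Q (v; s) is (1; v s).  On a in Abar,
    Q (a; 1) is (P a; 1), and integration by parts gives
      Q (a; v s) = Q (a * Q (v; s)) = P a * Q (v; s) - Q (P a * (v; s)),
    where (P a * v; s) is a shorter word, so the recursion stops ([int_word]).

    That Q is a Rota-Baxter operator ([int_op_rb]) rests on two closure
    properties of the relation Q x * Q y = Q (x * Q y + Q x * y) between
    elements x and y ([rb_rel_mull], [rb_rel_mulr]): if it holds for u, it holds
    for a * Q u under hypotheses on a and on Q a * u.  As (a; v s) = a * Q (v; s),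
    this reduces every pair of words to shorter ones, until either one of them
    is a bare element of Abar, where the relation is integration by parts
    ([int_op_rel_iota]), or both coefficients lie in V, where it is the recursion
    of the shuffle product ([int_op_rel_j]).

    An algebra morphism F from L to a Rota-Baxter algebra R that respects the
    integrals of Abar extends uniquely: the word (l; v1 .. vn) must go to F l
    times an iterated integral in R ([ext_fun]), and this is multiplicative
    since iterated integrals in any commutative Rota-Baxter algebra multiply by
    shuffles ([iter_int_shuffle]).  Composing this with the universal property of
    the ordinary localization ([loc_universal]) gives that of the Rota-Baxter
    localization ([ext_shuffle_localization]).  Finally the structure is carried
    along the algebra isomorphism from the extended shuffle algebra to the
    tensor product of L with the shuffle algebra ([ext_tensor_iso]). *)

Lemma lin_sub (k : pzRingType) (U W : lmodType k) (f : U -> W) :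
  linear f -> forall x y, f (x - y) = f x - f y.
Proof. by move=> lf x y; rewrite addrC -scaleN1r lf scaleN1r addrC. Qed.

(** * The Rota-Baxter relation between two elements *)

Section RotaBaxterRelation.
Variables (k : comPzRingType) (B : comPzAlgType k) (Q : B -> B).
Hypothesis linQ : linear Q.

(** Instances of the Rota-Baxter identity are isolated so that the identity can
    be proved by induction on the two arguments. *)
Definition rb_rel (x y : B) : Prop := Q x * Q y = Q (x * Q y + Q x * y).

Lemma rb_rel_sym x y : rb_rel x y -> rb_rel y x.
Proof. by rewrite /rb_rel [Q y * _]mulrC => ->; f_equal; ring. Qed.

Lemma rb_rel0l y : rb_rel 0 y.
Proof. by rewrite /rb_rel (lin0 linQ) !mul0r addr0 (lin0 linQ). Qed.

Lemma rb_rel_linl c x1 x2 y :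
  rb_rel x1 y -> rb_rel x2 y -> rb_rel (c *: x1 + x2) y.
Proof.
rewrite /rb_rel linQ !mulrDl -!pzscalerAl => -> ->.
by rewrite addrACA -scalerDr linQ.
Qed.

Lemma rb_relDl x1 x2 y : rb_rel x1 y -> rb_rel x2 y -> rb_rel (x1 + x2) y.
Proof. by move=> r1 r2; rewrite -[x1]scale1r; apply: rb_rel_linl. Qed.

Lemma rb_relDr x y1 y2 : rb_rel x y1 -> rb_rel x y2 -> rb_rel x (y1 + y2).
Proof.
by move=> r1 r2; apply/rb_rel_sym/rb_relDl; apply: rb_rel_sym.
Qed.

Lemma rb_rel_parts a u : rb_rel a u -> Q (a * Q u) = Q a * Q u - Q (Q a * u).
Proof. by rewrite /rb_rel (lin_add linQ) => ->; rewrite addrK. Qed.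

(** Both sides are expanded with [Q (a * Q u) = Q a * Q u - Q (Q a * u)]; the
    hypotheses turn every product of two integrals into integrals, and the terms
    containing [Q a * u] cancel. *)
Lemma rb_rel_mull a u y : rb_rel a u -> rb_rel a (u * Q y + Q u * y) ->
  rb_rel u y -> rb_rel (Q a * u) y -> rb_rel (a * Q u) y.
Proof.
move=> rau /rb_rel_parts raz ruy rauy; rewrite /rb_rel (rb_rel_parts rau).
rewrite mulrBl rauy -(mulrA (Q a) (Q u) (Q y)) ruy.
have -> : a * Q u * Q y + (Q a * Q u - Q (Q a * u)) * y
  = a * Q (u * Q y + Q u * y)
    + Q a * (u * Q y + Q u * y) - (Q a * u * Q y + Q (Q a * u) * y).
  by rewrite -ruy; ring.
by rewrite (lin_sub linQ) (lin_add linQ (a * _)) raz subrK.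
Qed.

(** The mirror image of [rb_rel_mull] would relate [b] to [z * Q a + Q z * a],
    which is no simpler than [b * Q z].  Here [a] and [b] are related instead, so
    [Q a * Q b] is itself an integral and has only to be related to [z]. *)
Lemma rb_rel_mulr a b z : rb_rel a b -> rb_rel b z -> rb_rel a (Q b * z) ->
  rb_rel (a * Q b + Q a * b) z -> rb_rel a (b * Q z).
Proof.
move=> rab rbz rabz rcz; rewrite /rb_rel (rb_rel_parts rbz).
rewrite mulrBr rabz (mulrA (Q a) (Q b) (Q z)) rab rcz -rab.
by rewrite -(lin_sub linQ); f_equal; ring.
Qed.

End RotaBaxterRelation.

(** * Words in the extended shuffle algebra *)

Section ExtendedShuffleFacts.
Variables (k : comPzRingType) (L : comPzAlgType k) (V : lmodType k).
Local Notation B := (ext_shuffle_alg L V).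
Local Notation W a s := (ext_word a s : B).

Lemma ext_word_linear s : linear (fun a : L => W a s).
Proof. exact: (ext_word_multilinear L V).1. Qed.

Lemma ext_word_cons_linear a s : linear (fun v : V => W a (v :: s)).
Proof. exact: ((ext_word_multilinear L V).2 a [::] s). Qed.

Lemma ext_word_coefM a b s : W a [::] * W b s = W (a * b) s.
Proof. by rewrite ext_wordM; apply: (shsum0l (ext_word (a * b)) s). Qed.

Lemma ext_word_ind (T : B -> Prop) :
  T 0 -> (forall c x y, T x -> T y -> T (c *: x + y)) ->
  (forall a s, T (W a s)) -> forall x, T x.
Proof. exact: ext_ind. Qed.

End ExtendedShuffleFacts.

(** * The operator on the extended shuffle algebra *)

(** The decomposition L = iota A + j V, with [rho] the projection to [V] and [p]
    the projection to [iota A] followed by the operator induced by [P]; only this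
    composite enters the construction. *)
Record rb_splitting (k : comPzRingType) (A L : comPzAlgType k) (V : lmodType k)
    (P : A -> A) (iota : A -> L) (j : V -> L) (p : L -> L) (rho : L -> V) :
    Prop := RBSplitting {
  split_iota : alg_hom iota;
  split_j : linear j;
  split_p : linear p;
  split_rho : linear rho;
  split_p_iota : forall a, p (iota a) = iota (P a);
  split_p_j : forall v, p (j v) = 0;
  split_rho_iota : forall a, rho (iota a) = 0;
  split_rho_j : forall v, rho (j v) = v;
  split_sum : forall l, exists a v, l = iota a + j v
}.

Section Integration.
Variables (k : comPzRingType) (A L : comPzAlgType k) (V : lmodType k).
Variables (P : A -> A) (iota : A -> L) (j : V -> L) (p : L -> L) (rho : L -> V).
Hypotheses (P_rb : rota_baxter P) (spl : rb_splitting P iota j p rho).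

Local Notation B := (ext_shuffle_alg L V).
Local Notation W a s := (ext_word a s : B).

(** For [l = a + v] with [a] in the image of [iota] and [v] in [V], [p l] is the
    integral of [a] and [rho l] is [v]: the last summand integrates the [V]-part
    by prefixing a letter, and the others integrate the [iota A]-part by parts. *)
Fixpoint int_word (l : L) (s : seq V) : B :=
  match s with
  | [::] => W (p l) [::] + W 1 [:: rho l]
  | v :: s' => W (p l) s - int_word (p l * j v) s' + W 1 (rho l :: s)
  end.

Definition int_op (x : B) : B := ext_lift int_word x.

Lemma int_word_linear s : linear (int_word^~ s).
Proof.
elim: s => [|v s IH] c l m /=.
  rewrite (split_p spl) (split_rho spl) ext_word_linear ext_word_cons_linear.
  by rewrite scalerDr addrACA.
rewrite (split_p spl) (split_rho spl) ext_word_linear ext_word_cons_linear.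
rewrite mulrDl -pzscalerAl IH !scalerDr scalerN opprD.
by rewrite [X in X + _ = _]addrACA [LHS]addrACA.
Qed.

Lemma int_word_multilinear : ext_multilinear int_word.
Proof.
split=> [|l s1 s2]; first exact: int_word_linear.
elim: s1 l => [|w s1 IH] l c u v /=.
  rewrite ext_word_cons_linear ((ext_word_multilinear L V).2 1 [:: rho l] s2).
  rewrite (split_j spl) mulrDr -pzscalerAr int_word_linear !scalerDr scalerN.
  rewrite opprD.
  by rewrite [X in X + _ = _]addrACA [LHS]addrACA.
rewrite IH ((ext_word_multilinear L V).2 _ (w :: s1) s2).
rewrite ((ext_word_multilinear L V).2 1 [:: rho l, w & s1] s2) /=.
rewrite !scalerDr scalerN opprD.
by rewrite [X in X + _ = _]addrACA [LHS]addrACA.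
Qed.

Lemma int_op_linear : linear int_op.
Proof. exact: (ext_lift_linear int_word_multilinear). Qed.

Lemma int_op_word l s : int_op (W l s) = int_word l s.
Proof. exact: (ext_lift_word l s int_word_multilinear). Qed.

Lemma int_op_j v s : int_op (W (j v) s) = W 1 (v :: s).
Proof.
rewrite int_op_word; case: s => [|w s] /=;
  rewrite (split_p_j spl) (split_rho_j spl) (lin0 (ext_word_linear _));
  rewrite ?add0r //.
by rewrite mul0r (lin0 (int_word_linear s)) oppr0 add0r.
Qed.

Lemma int_op_iota a : int_op (W (iota a) [::]) = W (iota (P a)) [::].
Proof.
rewrite int_op_word /= (split_p_iota spl) (split_rho_iota spl).
by rewrite (lin0 (ext_word_cons_linear _ _)) addr0.
Qed.

(** Every word is built from coefficients by multiplication and integration; the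
    inductions on words below all use this factorization. *)
Lemma ext_word_consE l v s : W l (v :: s) = W l [::] * int_op (W (j v) s).
Proof. by rewrite int_op_j ext_word_coefM mulr1. Qed.

Local Notation rel := (rb_rel int_op).

(** This case is integration by parts, which the operator satisfies by
    construction. *)
Lemma int_op_rel_iota_j a v s : rel (W (iota a) [::]) (W (j v) s).
Proof.
rewrite /rb_rel int_op_iota int_op_j !ext_word_coefM !mulr1.
rewrite (lin_add int_op_linear) [int_op (W _ (v :: s))]int_op_word /=.
rewrite (split_p_iota spl) (split_rho_iota spl).
by rewrite (lin0 (ext_word_cons_linear _ _)) addr0 int_op_word subrK.
Qed.

(** Induction on the word: in [W (iota b) (v :: s) = W (iota b) [::] * Q u], the
    element [u] is a shorter word.  All that [rb_rel_mulr] then asks is to relate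
    coefficients from [iota A] to [u] multiplied by such coefficients, and to each
    other; the latter is the Rota-Baxter identity of [P]. *)
Lemma int_op_rel_iota a x : rel (W (iota a) [::]) x.
Proof.
have lQ := int_op_linear; elim/ext_word_ind: x a => [|c x y rx ry|l s] a.
- exact/rb_rel_sym/rb_rel0l.
- by apply: rb_rel_sym; apply: rb_rel_linl; rewrite // => *; apply: rb_rel_sym.
have [[i_lin [i1 iM]] [P_lin PM]] := (split_iota spl, P_rb).
elim: s l a => [|v s IH] l a; have [b [w ->]] := split_sum spl l;
  rewrite (lin_add (ext_word_linear _)); apply: rb_relDr => //;
  try exact: int_op_rel_iota_j.
- rewrite /rb_rel !int_op_iota !ext_word_coefM -(lin_add (ext_word_linear _)).
  by rewrite -!iM -(lin_add i_lin) int_op_iota PM.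
(* The induction hypothesis is general in both coefficients, hence gives the three
   relations with a word on [s]. *)
rewrite ext_word_consE; apply: rb_rel_mulr => //; first last.
- rewrite !int_op_iota !ext_word_coefM -(lin_add (ext_word_linear _)).
  by rewrite -!iM -(lin_add i_lin).
- by rewrite int_op_iota ext_word_coefM.
rewrite /rb_rel !int_op_iota !ext_word_coefM -(lin_add (ext_word_linear _)).
by rewrite -!iM -(lin_add i_lin) int_op_iota PM.
Qed.

(** A shuffle of [v :: s] with [w :: t] starts with [v] or with [w], which gives
    the two terms of the Rota-Baxter identity. *)
Lemma int_op_rel_j v s w t : rel (W (j v) s) (W (j w) t).
Proof.
have lQ := int_op_linear; rewrite /rb_rel !int_op_j !ext_wordM mulr1 mul1r.
rewrite (lin_add lQ) !(lin_sum lQ) /= big_cat !big_map mulr1.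
by congr (_ + _); apply: eq_bigr => u _; rewrite int_op_j.
Qed.

(** The induction is on the total length because the two words exchange their
    roles when only the second one has its coefficient in [iota A]. *)
Lemma int_op_rel_word l s m t : rel (W l s) (W m t).
Proof.
have lQ := int_op_linear; have [n] := ubnP (size s + size t).
elim: n => // n IH in l s m t *.
have iota_case a s' m' t' : (size s' + size t' < n.+1)%N ->
    rel (W (iota a) s') (W m' t').
  case: s' => [|v s'] lt_n; first exact: int_op_rel_iota.
  rewrite ext_word_consE; apply: rb_rel_mull => //; try exact: int_op_rel_iota.
    exact: IH.
  by rewrite int_op_iota ext_word_coefM; apply: IH.
move=> lt_n; have [a [v ->]] := split_sum spl l.
rewrite (lin_add (ext_word_linear _)); apply: rb_relDl => //.
  exact: iota_case.
have [b [w ->]] := split_sum spl m.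
rewrite (lin_add (ext_word_linear _)); apply: rb_relDr => //.
  by apply/rb_rel_sym/iota_case; rewrite addnC.
exact: int_op_rel_j.
Qed.

Lemma int_op_rb : rota_baxter int_op.
Proof.
have lQ := int_op_linear; split=> // x y.
elim/ext_word_ind: x => [|c x1 x2|l s].
- exact: rb_rel0l.
- exact: rb_rel_linl.
apply: rb_rel_sym; elim/ext_word_ind: y => [|c y1 y2|m t].
- exact: rb_rel0l.
- exact: rb_rel_linl.
exact: int_op_rel_word.
Qed.

(** * Extension of morphisms by iterated integrals *)

Section Extension.
Variables (R : comPzAlgType k) (PR : R -> R) (F : L -> R).
Hypotheses (PR_rb : rota_baxter PR) (F_hom : alg_hom F).
Hypothesis F_iota : forall a, F (iota (P a)) = PR (F (iota a)).

Fixpoint iter_int (s : seq V) : R :=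
  if s is v :: s' then PR (F (j v) * iter_int s') else 1.

Lemma iter_int_multilinear : multilinear iter_int.
Proof.
elim=> [|w s1 IH] s2 c u v /=.
  by rewrite (split_j spl) F_hom.1 mulrDl -pzscalerAl PR_rb.1.
by rewrite IH mulrDr -pzscalerAr PR_rb.1.
Qed.

(** The Rota-Baxter identity for two iterated integrals is the recursion that
    defines the shuffles. *)
Lemma iter_int_shuffle s t :
  iter_int s * iter_int t = shsum iter_int s t.
Proof.
have lPR := PR_rb.1.
have int_shsum v s' t' : shsum (fun u => iter_int (v :: u)) s' t' =
    PR (F (j v) * shsum iter_int s' t').
  by rewrite /shsum mulr_sumr (lin_sum lPR).
elim: s t => [|v s IHs] t; first by rewrite mul1r shsum0l.
elim: t => [|w t IHt]; first by rewrite mulr1 shsum0r.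
rewrite shsum_cons !int_shsum -IHs -IHt /= PR_rb.2 (lin_add lPR).
by congr (_ + _); f_equal; ring.
Qed.

(** The only possible extension of [F], by [ext_word_consE]. *)
Definition ext_fun (x : B) : R := ext_lift (fun l s => F l * iter_int s) x.

Lemma ext_fun_multilinear : ext_multilinear (fun l s => F l * iter_int s).
Proof.
split=> [s c l m|l s1 s2 c u v].
  by rewrite F_hom.1 mulrDl -pzscalerAl.
by rewrite iter_int_multilinear mulrDr -pzscalerAr.
Qed.

Lemma ext_fun_linear : linear ext_fun.
Proof. exact: (ext_lift_linear ext_fun_multilinear). Qed.

Lemma ext_fun_word l s : ext_fun (W l s) = F l * iter_int s.
Proof. exact: (ext_lift_word l s ext_fun_multilinear). Qed.

Lemma ext_fun_mul x y : ext_fun (x * y) = ext_fun x * ext_fun y.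
Proof.
have [lf [F1 FM]] := (ext_fun_linear, F_hom.2).
elim/ext_word_ind: x => [|c x1 x2 e1 e2|l s].
- by rewrite mul0r (lin0 lf) mul0r.
- by rewrite mulrDl -pzscalerAl !lf e1 e2 mulrDl -pzscalerAl.
elim/ext_word_ind: y => [|c x1 x2 e1 e2|m t].
- by rewrite mulr0 (lin0 lf) mulr0.
- by rewrite mulrDr -pzscalerAr !lf e1 e2 mulrDr -pzscalerAr.
rewrite ext_wordM (lin_sum lf) !ext_fun_word mulrACA -FM iter_int_shuffle.
by rewrite mulr_sumr; apply: eq_bigr => u _; rewrite ext_fun_word.
Qed.

Lemma ext_fun_coef l : ext_fun (W l [::]) = F l.
Proof. by rewrite ext_fun_word mulr1. Qed.

Lemma ext_fun_hom : alg_hom ext_fun.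
Proof.
have lf := ext_fun_linear; split=> //; split; last exact: ext_fun_mul.
by rewrite -[RHS]F_hom.2.1 -ext_fun_coef.
Qed.

(** On a coefficient [iota a], both operators are determined by integration by
    parts, so the claim reduces to a shorter word. *)
Lemma ext_fun_int x : ext_fun (int_op x) = PR (ext_fun x).
Proof.
have [lf lQ lPR] := And3 ext_fun_linear int_op_linear PR_rb.1.
elim/ext_word_ind: x => [|c x y ex ey|l s].
- by rewrite (lin0 lQ) (lin0 lf) (lin0 lPR).
- by rewrite lQ !lf lPR ex ey.
elim: s l => [|v s IH] l; have [a [w ->]] := split_sum spl l;
  rewrite (lin_add (ext_word_linear _)) (lin_add lQ) !(lin_add lf);
  rewrite (lin_add lPR);
  congr (_ + _); rewrite ?int_op_j ?ext_fun_word ?F_hom.2.1 ?mul1r //.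
  by rewrite int_op_iota ext_fun_coef mulr1.
rewrite ext_word_consE (rb_rel_parts lQ); last exact: int_op_rel_iota_j.
rewrite (lin_sub lf) int_op_iota ext_fun_mul ext_word_coefM int_op_j IH.
rewrite !ext_fun_word !F_hom.2.1 !mul1r !mulr1 F_hom.2.2.
by rewrite F_iota -mulrA -(rb_rel_parts lPR) //; apply: PR_rb.2.
Qed.

Lemma ext_fun_unique (h : B -> R) :
  rb_hom int_op PR h -> (forall l, h (W l [::]) = F l) -> h =1 ext_fun.
Proof.
move=> [[lh [h1 hM]] hQ] hF x; have lf := ext_fun_linear.
elim/ext_word_ind: x => [|c x y ex ey|l s].
- by rewrite (lin0 lh) (lin0 lf).
- by rewrite lh lf ex ey.
elim: s l => [|v s IH] l; first by rewrite hF ext_fun_coef.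
rewrite ext_word_consE hM hQ hF IH ext_fun_mul ext_fun_int.
by rewrite ext_fun_coef.
Qed.

End Extension.

End Integration.

(** * Universal property of the localization *)

Section LocalizationUniversal.
Variables (k : comPzRingType) (A : comPzAlgType k) (S : mulrClosed A).
Variables (R : comPzAlgType k) (f : A -> R).
Hypotheses (f_hom : alg_hom f) (f_inv : forall s, s \in S -> invertible (f s)).

Local Notation i := (loc_map S : A -> localization S).

(** The graph of the morphism induced by [f] on the localization: [r] is a value
    of the fraction [q] when [q = a / s] and [r = f a / f s] for some [a], [s].  It
    is closed under the operations, so the morphism needs no computation with
    chosen representatives. *)
Definition loc_rel (q : localization S) (r : R) : Prop :=
  exists a s, [/\ s \in S, q * i s = i a & r * f s = f a].

Lemma invertible_mulIr (x y z : R) : invertible x -> y * x = z * x -> y = z.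
Proof.
by move=> [t xt] e; rewrite -[y]mulr1 -[z]mulr1 -xt !mulrA e.
Qed.

Lemma loc_rel_total q : exists r, loc_rel q r.
Proof.
have [a [s [Ss e]]] := loc_surj q; have [t st] := f_inv Ss.
by exists (f a * t), a, s; split=> //; rewrite -mulrA [t * _]mulrC st mulr1.
Qed.

Lemma loc_rel_fun q r r' : loc_rel q r -> loc_rel q r' -> r = r'.
Proof.
have [[li [i1 iM]] [lf [f1 fM]]] := (loc_map_hom S, f_hom).
move=> [a [s [Ss qs rs]]] [b [t [St qt rt]]].
have [u Su] : exists2 u, u \in S & u * (a * t - b * s) = 0.
  apply/loc_map_eq0; rewrite (lin_sub li) !iM -qs -qt.
  by rewrite mulrAC subrr.
move/(congr1 f); rewrite (lin0 lf) fM (lin_sub lf) !fM mulrBr => /eqP.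
rewrite subr_eq0 -rs -rt => /eqP e.
apply: (invertible_mulIr (f_inv Su)); apply: (invertible_mulIr (f_inv Ss)).
apply: (invertible_mulIr (f_inv St)).
have -> : r * f u * f s * f t = f u * (r * f s * f t) by ring.
by rewrite e; ring.
Qed.

Lemma loc_rel_map a : loc_rel (i a) (f a).
Proof.
have [[li [i1 iM]] [lf [f1 fM]]] := (loc_map_hom S, f_hom).
by exists a, 1; rewrite rpred1 i1 f1 !mulr1.
Qed.

Lemma loc_rel_lin c q q' r r' :
  loc_rel q r -> loc_rel q' r' -> loc_rel (c *: q + q') (c *: r + r').
Proof.
have [[li [i1 iM]] [lf [f1 fM]]] := (loc_map_hom S, f_hom).
move=> [a [s [Ss qs rs]]] [b [t [St qt rt]]].
exists (c *: (a * t) + b * s), (s * t); split; first exact: rpredM.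
  by rewrite li !iM -qs -qt mulrDl -!pzscalerAl; congr (_ *: _ + _); ring.
by rewrite lf !fM -rs -rt mulrDl -!pzscalerAl; congr (_ *: _ + _); ring.
Qed.

Lemma loc_relM q q' r r' :
  loc_rel q r -> loc_rel q' r' -> loc_rel (q * q') (r * r').
Proof.
have [[li [i1 iM]] [lf [f1 fM]]] := (loc_map_hom S, f_hom).
move=> [a [s [Ss qs rs]]] [b [t [St qt rt]]].
exists (a * b), (s * t); split; first exact: rpredM.
  by rewrite !iM -qs -qt; ring.
by rewrite !fM -rs -rt; ring.
Qed.

Lemma loc_universal : exists F : localization S -> R,
  [/\ alg_hom F, forall a, F (i a) = f a &
    forall h : localization S -> R, alg_hom h -> (forall a, h (i a) = f a) ->
      h =1 F].
Proof.
have [F FP] := choice loc_rel_total; exists F.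
have F_i a : F (i a) = f a by apply: loc_rel_fun (FP _) (loc_rel_map a).
have [[li [i1 iM]] [lf [f1 fM]]] := (loc_map_hom S, f_hom).
split=> //; first split; last 1 first.
- move=> h [lh [h1 hM]] h_i q; apply: loc_rel_fun (FP q).
  have [a [s [Ss e]]] := loc_surj q; exists a, s; split=> //.
  by rewrite -!h_i -hM e.
- by move=> c q q'; apply: loc_rel_fun (FP _) _; apply: loc_rel_lin.
split=> [|q q']; first by rewrite -i1 F_i.
by apply: loc_rel_fun (FP _) _; apply: loc_relM.
Qed.

End LocalizationUniversal.

(** * Transport to the tensor product *)

Section Transport.
Variables (k : comPzRingType).

(** The two algebras differ only in degree 0, where L stands for L (x) k. *)
Lemma ext_tensor_iso (L : comPzAlgType k) (V : lmodType k) :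
  exists phi : ext_shuffle_alg L V -> tensor_alg L (shuffle_alg V),
    [/\ alg_hom phi, bijective phi
      & forall a s, phi (ext_word a s) = tens a (word s)].
Proof.
pose T := tensor_alg L (shuffle_alg V).
pose phi_word (a : L) (s : seq V) : T := tens a (word s : shuffle_alg V).
have mphi : ext_multilinear phi_word.
  split=> [s c a b|a s1 s2 c u v]; first exact: (tens_bilin _ _).1.
  rewrite /phi_word word_multilinear; exact: (tens_bilin _ _).2.
pose phi (x : ext_shuffle_alg L V) : T := ext_lift phi_word x.
have lphi : linear phi by apply: (ext_lift_linear mphi).
have phiE a s : phi (ext_word a s) = tens a (word s : shuffle_alg V).
  exact: (ext_lift_word a s mphi).
have bshift : bilin (fun a (x : shuffle_alg V) => ext_shift a x : ext_type L V).
  split=> [x c a b|a]; last exact: ext_shift_linear.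
  elim/shuffle_ind: x => [|d x y ex ey|s].
  - by rewrite !(lin0 (ext_shift_linear _)) scaler0 addr0.
  - rewrite !ext_shift_linear ex ey !scalerDr !scalerA [d * c]mulrC.
    by rewrite [LHS]addrACA.
  - by rewrite !ext_shift_word; apply: ext_word_linear.
pose psi (x : T) : ext_shuffle_alg L V := tensor_lift (@ext_shift k L V) x.
have lpsi : linear psi by apply: (tensor_lift_linear bshift).
have psiE a x : psi (tens a x) = ext_shift a x by apply: tensor_lift_tens.
exists phi; split=> //.
  split=> //; split; first exact: (phiE 1 [::]).
  move=> x y; elim/ext_word_ind: x => [|c x1 x2 e1 e2|a s].
  - by rewrite mul0r (lin0 lphi) mul0r.
  - by rewrite mulrDl -pzscalerAl !lphi e1 e2 mulrDl -pzscalerAl.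
  elim/ext_word_ind: y => [|c x1 x2 e1 e2|b t].
  - by rewrite mulr0 (lin0 lphi) mulr0.
  - by rewrite mulrDr -pzscalerAr !lphi e1 e2 mulrDr -pzscalerAr.
  rewrite ext_wordM (lin_sum lphi) !phiE.
  rewrite [RHS](tensor_mul_tens a (word s : shuffle_alg V) b (word t)) wordM.
  rewrite (lin_sum ((tens_bilin _ _).2 (a * b))).
  by apply: eq_bigr => u _; apply: phiE.
exists psi => x.
  elim/ext_word_ind: x => [|c x y ex ey|a s].
  - by rewrite (lin0 lphi) (lin0 lpsi).
  - by rewrite lphi lpsi ex ey.
  - by rewrite phiE psiE ext_shift_word.
elim/tensor_ind': x => [|c x y ex ey|a x].
- by rewrite (lin0 lpsi) (lin0 lphi).
- by rewrite lpsi lphi ex ey.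
rewrite psiE; have lt := (tens_bilin L (shuffle_alg V)).2 a.
elim/shuffle_ind: x => [|c x y ex ey|s].
- by rewrite (lin0 (ext_shift_linear a)) (lin0 lphi) (lin0 lt).
- by rewrite ext_shift_linear lphi ex ey lt.
- by rewrite ext_shift_word phiE.
Qed.

Variables (A : comPzAlgType k) (P : A -> A) (S : {pred A}).

Lemma rb_localization_iso (B B' : comPzAlgType k) (Q : B -> B) (i : A -> B)
    (phi : B -> B') :
  alg_hom phi -> bijective phi -> rb_localization P S Q i ->
  exists Q' : B' -> B', rb_localization P S Q' (fun a => phi (i a)).
Proof.
move=> [lphi [phi1 phiM]] [psi phiK psiK].
move=> [[lQ QM] [[li [i1 iM]] iP] i_inv univ].
have phi_inj := can_inj phiK.
have lpsi : linear psi by move=> c x y; apply: phi_inj; rewrite lphi !psiK.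
have psi1 : psi 1 = 1 by apply: phi_inj; rewrite psiK phi1.
have psiM x y : psi (x * y) = psi x * psi y.
  by apply: phi_inj; rewrite phiM !psiK.
exists (fun x => phi (Q (psi x))); split.
- split=> [c x y|x y]; first by rewrite lpsi lQ lphi.
  by rewrite (lin_add lpsi) !psiM !phiK -QM phiM.
- split; last by move=> a; rewrite phiK iP.
  split; first by move=> c x y; rewrite li lphi.
  by split=> [|x y]; rewrite ?i1 // iM phiM.
- move=> s Ss; have [t st] := i_inv s Ss.
  by exists (phi t); rewrite -phiM st.
move=> R PR f PR_rb f_hom f_inv.
have [g [g_hom gi g_uniq]] := univ R PR f PR_rb f_hom f_inv.
have [[lg [g1 gM]] gQ] := g_hom.
exists (fun x => g (psi x)); split=> [|a|h [[lh [h1 hM]] hQ] hi x].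
- split; last by move=> x; rewrite phiK gQ.
  split; first by move=> c x y; rewrite lpsi lg.
  by split=> [|x y]; rewrite ?psi1 // psiM gM.
- by rewrite phiK gi.
rewrite -[in LHS](psiK x); apply: (g_uniq (fun y => h (phi y))) => //.
split; last by move=> y; rewrite -hQ phiK.
split; first by move=> c y z; rewrite lphi lh.
by split=> [|y z]; rewrite ?phi1 // phiM hM.
Qed.

End Transport.

(** * The splitting given by a direct sum *)

Section DirectSumSplitting.
Variables (k : comPzRingType) (A L : comPzAlgType k) (P : A -> A) (i : A -> L).
Variable V : submodClosed L.

Local Notation j := (val : submod_type V -> L).

(** The hypothesis on [P] makes the operator induced on the image of [i]
    independent of the chosen preimage. *)
Lemma direct_sum_splitting :
  alg_hom i -> linear P -> (forall a, i a = 0 -> i (P a) = 0) ->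
  direct_sum (fun x : L => exists a, x = i a) (fun x => x \in V) ->
  exists p rho, rb_splitting P i j p rho.
Proof.
move=> i_hom lP P_image LAV; have li := i_hom.1.
have lj : linear j by [].
have i_P a b : i a = i b -> i (P a) = i (P b).
  move=> e; apply/eqP; rewrite -subr_eq0 -(lin_sub li) -(lin_sub lP).
  by apply/eqP/P_image; rewrite (lin_sub li) e subrr.
have [|dec decE] := @choice L (A * submod_type V)%type
  (fun l d => l = i d.1 + j d.2).
  move=> l; have [[x y] [[/= [a xa] Vy e] _]] := LAV l.
  by exists (a, exist _ y Vy); rewrite e xa.
have dec_uniq a v l : l = i a + j v -> i (dec l).1 = i a /\ (dec l).2 = v.
  move=> e; have [d [_ d_uniq]] := LAV l.
  have Vd (w : submod_type V) : j w \in V by apply: valP.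
  have e1 := d_uniq (i a, j v) (And3 (ex_intro _ a erefl) (Vd v) e).
  have e2 := d_uniq (i (dec l).1, j (dec l).2)
    (And3 (ex_intro _ _ erefl) (Vd _) (decE l)).
  by move: e2; rewrite e1 => -[-> /val_inj ->].
pose p l := i (P (dec l).1); pose rho l := (dec l).2.
have pE a v l : l = i a + j v -> p l = i (P a).
  by move=> /dec_uniq[/i_P].
have rhoE a v l : l = i a + j v -> rho l = v by move=> /dec_uniq[].
have lin_dec c l m : c *: l + m =
    i (c *: (dec l).1 + (dec m).1) + j (c *: (dec l).2 + (dec m).2).
  by rewrite {1}[l]decE {1}[m]decE lj li scalerDr [LHS]addrACA.
have i_dec a : i a = i a + j 0 by rewrite (lin0 lj) addr0.
have j_dec v : j v = i 0 + j v by rewrite (lin0 li) add0r.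
exists p, rho; split=> // [c l m|c l m|a|v|a|v|l].
- by rewrite (pE _ _ _ (lin_dec c l m)) lP li.
- exact: rhoE (lin_dec c l m).
- exact: pE (i_dec a).
- by rewrite (pE _ _ _ (j_dec v)) (lin0 lP) (lin0 li).
- exact: rhoE (i_dec a).
- exact: rhoE (j_dec v).
- by exists (dec l).1, (dec l).2.
Qed.

End DirectSumSplitting.

(** * The Rota-Baxter localization *)

Lemma ext_shuffle_localization (k : comPzRingType) (A : comPzAlgType k)
    (P : A -> A) (S : mulrClosed A) (V : lmodType k) (j : V -> localization S)
    (p : localization S -> localization S) (rho : localization S -> V) :
  rota_baxter P ->
  rb_splitting P (loc_map S : A -> localization S) j p rho ->
  rb_localization P S (int_op j p rho)
    (fun a => ext_word (loc_map S a : localization S) [::] :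
      ext_shuffle_alg (localization S) V).
Proof.
move=> P_rb spl.
have [li [i1 iM]] := loc_map_hom S.
have lw := @ext_word_linear k (localization S) V [::].
split; first exact: (int_op_rb P_rb spl).
- split; last by move=> a; rewrite (int_op_iota spl).
  split; first by move=> c a b; rewrite li lw.
  split=> [|a b]; first by rewrite i1.
  by rewrite iM [RHS]ext_word_coefM.
- move=> s Ss; have [t st] := loc_map_inv Ss; exists (ext_word t [::]).
  by rewrite [LHS]ext_word_coefM st.
move=> R PR f PR_rb [f_hom fP] f_inv.
have [F [F_hom Fi F_uniq]] := loc_universal f_hom f_inv.
have F_iota a : F (loc_map S (P a)) = PR (F (loc_map S a)) by rewrite !Fi.
exists (ext_fun j PR F); split.
- split; first exact: (ext_fun_hom spl PR_rb F_hom).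
  exact: (ext_fun_int spl PR_rb F_hom F_iota).
- by move=> a; rewrite [LHS](ext_fun_coef spl PR_rb F_hom) Fi.
move=> h h_hom h_i.
apply: (ext_fun_unique spl PR_rb F_hom F_iota h_hom) => l.
apply: (F_uniq (fun l => h (ext_word l [::]))) => //.
have [[lh [h1 hM]] _] := h_hom.
split; first by move=> c x y; rewrite lw lh.
by split=> [|x y]; rewrite ?[LHS]h1 // -hM ext_word_coefM.
Qed.

Theorem theorem3p4 (k : comPzRingType) (A : comPzAlgType k) (P : A -> A)
    (S : mulrClosed A) (V : submodClosed (localization S))
    (P_rb : rota_baxter P)
    (P_image : descends_to_image S P)
    (LAV : direct_sum (fun x : localization S => exists a, x = loc_map S a)
             (fun x => x \in V)) :
  [/\ exists Q : rb_ext V -> rb_ext V, rb_localization P S Q (to_ext V),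
      exists Q : rb_tensor V -> rb_tensor V,
        rb_localization P S Q (to_tensor V)
    & exists phi : rb_ext V -> rb_tensor V,
        [/\ alg_hom phi, bijective phi
          & forall (a : localization S) (s : seq (submod_type V)),
              phi (ext_word a s) = tens a (word s)]].
Proof.
have [p [rho spl]] := direct_sum_splitting (loc_map_hom S) P_rb.1 P_image LAV.
have [phi [phi_hom phi_bij phi_word]] :=
  ext_tensor_iso (localization S) (submod_type V).
have ext_loc := ext_shuffle_localization P_rb spl.
split; last by exists phi.
  by exists (int_op val p rho).
have [Q' Q'_loc] := rb_localization_iso phi_hom phi_bij ext_loc.
exists Q'; suff -> : to_tensor V = fun a => phi (to_ext V a) by [].
by apply: funext => a; rewrite phi_word.
Qed.
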